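(* Let $(Y_t)_{t\ge 0}$ be a continuous nonnegative local submartingale with $Y_0=0$, and let $Y_t=M_tC_t-1$ be its multiplicative decomposition, where $M$ is a continuous strictly positive local martingale with $M_0=1$ and $C$ is a continuous adapted increasing process with $C_0=1$. Then the following are equivalent: (1) $(Y_t)_{t\ge 0}$ is of class $(D)$; (2) $(M_t)_{t\ge 0}$ is a uniformly integrable martingale and $\mathbb{E}[M_\infty C_\infty]<\infty$; (3) $(M_t)_{t\ge 0}$ is a uniformly integrable martingale and $\mathbb{E}\left[\int_0^\infty M_s\,dC_s\right]<\infty$.
   Context: All processes live on a filtered probability space $(\Omega,\mathcal{F},(\mathcal{F}_t)_{t\ge0},\mathbb{P})$ satisfying the usual assumptions. Every continuous nonnegative local submartingale $Y$ with $Y_0=0$ has a unique decomposition $Y_t=M_tC_t-1$ of the stated form; explicitly, if $Y=m+\ell$ is its Doob-Meyer decomposition ($m$ a continuous local martingale, $\ell$ continuous increasing, $m_0=\ell_0=0$), then $C_t=\exp\left(\int_0^t\frac{d\ell_s}{1+Y_s}\right)$ and $M_t=(1+Y_t)/C_t$. A process $Y$ is of class $(D)$ if the family $\{Y_T: T \text{ a finite stopping time}\}$ is uniformly integrable. $M_\infty=\lim_{t\to\infty}M_t$ (a.s.), $C_\infty=\lim_{t\to\infty}C_t\in[1,\infty]$, and $M_\infty C_\infty$ is computed with the convention $0\cdot\infty=0$. ''Increasing'' means nondecreasing. *)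

(* Defs.v *)
From HB Require Import structures.
From mathcomp Require Import all_boot all_order all_algebra.
From mathcomp Require Import all_classical all_reals all_analysis.

Set Implicit Arguments.
Unset Strict Implicit.
Unset Printing Implicit Defensive.

Import Order.TTheory GRing.Theory Num.Theory.
Import numFieldNormedType.Exports.

Local Open Scope classical_set_scope.
Local Open Scope ring_scope.

(* A process is a map X : R -> T -> R, (t, w) |-> X_t(w), and a filtration is a
   map F : R -> set (set T). Only times t >= 0 are meaningful: nothing below
   constrains, or depends on, the values at negative times. *)

Section processes.
Context {d : measure_display} {T : measurableType d} {R : realType}.
Variables (P : probability T R) (F : R -> set (set T)).
Implicit Types (X : R -> T -> R) (tau : T -> \bar R).

Definition filtration :=
  (forall t : R, 0 <= t -> sigma_algebra setT (F t) /\ F t `<=` measurable) /\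
  (forall s t : R, 0 <= s -> s <= t -> F s `<=` F t).

(* The last clause also makes (T, P) complete, since F 0 is contained in the
   ambient sigma-algebra. *)
Definition usual_conditions :=
  [/\ filtration,
      (forall t : R, 0 <= t -> \bigcap_(s in `]t, +oo[) F s = F t) &
      (forall N, P.-negligible N -> F 0 N)].

Definition measurable_wrt (G : set (set T)) (Z : T -> R) :=
  forall B : set R, measurable B -> G (Z @^-1` B).

Definition adapted X := forall t : R, 0 <= t -> measurable_wrt (F t) (X t).

Definition continuous_process X :=
  forall w, {within `[0, +oo[, continuous (fun t => X t w)}.

Definition nondecreasing_process X :=
  forall w (s t : R), 0 <= s -> s <= t -> X s w <= X t w.

(* Z is a version of the conditional expectation E[X | G]. *)
Definition is_cond_exp (G : set (set T)) (X Z : T -> R) :=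
  [/\ measurable_wrt G Z,
      P.-integrable setT (EFin \o Z) &
      forall A, G A ->
        (\int[P]_(w in A) (Z w)%:E = \int[P]_(w in A) (X w)%:E)%E].

Definition martingale X :=
  [/\ adapted X,
      (forall t : R, 0 <= t -> P.-integrable setT (EFin \o X t)) &
      forall s t : R, 0 <= s -> s <= t -> is_cond_exp (F s) (X t) (X s)].

Definition submartingale X :=
  [/\ adapted X,
      (forall t : R, 0 <= t -> P.-integrable setT (EFin \o X t)) &
      forall s t : R, 0 <= s -> s <= t -> exists Z : T -> R,
        is_cond_exp (F s) (X t) Z /\ {ae P, forall w, X s w <= Z w}].

Definition stopping_time tau :=
  (forall w, 0 <= tau w)%E /\
  (forall t : R, 0 <= t -> F t [set w | tau w <= t%:E]%E).

Definition stopped_process X tau (t : R) (w : T) : R :=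
  X (fine (mine t%:E (tau w))) w.

(* X - X_0 is localized, so that no integrability of X_0 is required. *)
Definition localized (Q : (R -> T -> R) -> Prop) X :=
  adapted X /\
  exists tau : nat -> T -> \bar R,
    [/\ (forall n, stopping_time (tau n)),
        {ae P, forall w, nondecreasing_seq (tau ^~ w) /\
                         tau n w @[n --> \oo] --> +oo%E} &
        forall n, Q (fun t w => stopped_process X (tau n) t w - X 0 w)].

Definition local_martingale X := localized martingale X.

Definition local_submartingale X := localized submartingale X.

Definition uniformly_integrable (H : set (T -> R)) :=
  (forall Z, H Z -> measurable_fun setT Z) /\
  (forall e : R, 0 < e -> exists K : R, forall Z, H Z ->
     (\int[P]_(w in [set w | (K <= `|Z w|)%R]) `|Z w|%:E <= e%:E)%E).

Definition ui_martingale X :=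
  martingale X /\ uniformly_integrable [set X t | t in `[0, +oo[].

Definition class_D X :=
  uniformly_integrable
    [set (fun w => X (fine (tau w)) w) | tau in
       [set tau | stopping_time tau /\ forall w, (tau w < +oo)%E]].

(* The terminal value X_oo, with values in the extended reals; it is the
   default element of \bar R at the points where the limit does not exist. *)
Definition terminal X (w : T) : \bar R := lim ((X t w)%:E @[t --> +oo]).

End processes.

Section stieltjes.
Context {R : realType}.

(* lebesgue_stieltjes_measure takes a bundled nondecreasing right-continuous
   function on the whole real line. A function c on [0, +oo[ is extended to the
   left by the constant c 0, hence creates no mass at 0, and is then bundled. The
   identity is a dummy value, not used for nondecreasing continuous c (see
   cumulative_pathE). *)
Definition extend0 (c : R -> R) : R -> R := fun t => c (Num.max t 0).

Definition cumulative_path (c : R -> R) : cumulative R R :=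
  match pselect (nondecreasing (extend0 c) /\ right_continuous (extend0 c)) with
  | left h => Cumulative.Pack
      (Cumulative.Class (isCumulative.Build R _ R (extend0 c) h.1 h.2))
  | right _ => idfun
  end.

Lemma cumulative_pathE (c : R -> R) :
  (forall s t : R, 0 <= s -> s <= t -> c s <= c t) ->
  {within `[0, +oo[, continuous c} ->
  cumulative_path c = extend0 c :> (R -> R).
Proof.
move=> ndc cc; rewrite /cumulative_path; case: pselect => //= -[]; split.
  move=> x y xy; rewrite /extend0; apply: ndc; first by rewrite le_max lexx orbT.
  by rewrite ge_max !le_max xy lexx /= orbT.
apply: right_continuousW.
have max_cont : continuous (fun t : R => Num.max t 0).
  by move=> t; apply: (@continuous_max R R id (cst 0)) => //; exact: cvg_cst.
have max_ge0 (t : R) : `[0, +oo[%classic (Num.max t 0).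
  by rewrite /= in_itv /= andbT le_max lexx orbT.
move=> t; apply: (@cvg_comp _ _ _ _ _ _ (within `[0, +oo[ (nbhs (Num.max t 0)))).
  move=> B /max_cont /= h; change (nbhs t ((Num.max^~ 0) @^-1` B)).
  by move: h; apply: (@filterS R (nbhs t)) => s; apply; exact: max_ge0.
by move/subspace_continuousP : cc; apply.
Qed.

(* The pathwise integral of m with respect to dc over [0, +oo[. *)
Definition stieltjes_integral (m c : R -> R) : \bar R :=
  (\int[lebesgue_stieltjes_measure (cumulative_path c)]_(s in `[0%R, +oo[)
     (m s)%:E)%E.

End stieltjes.

(* Main.v *)
Require Import Defs.
From HB Require Import structures.
From mathcomp Require Import all_boot all_order all_algebra.
From mathcomp Require Import all_classical all_reals all_analysis.
From mathcomp Require Import measurable_realfun ring lra.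
Import Order.TTheory GRing.Theory Num.Theory.
Import numFieldNormedType.Exports.
Local Open Scope classical_set_scope.
Local Open Scope ring_scope.

(** Write X = M C = 1 + Y, Z = M_oo C_oo, and measure uniform integrability by the
    excess (x - K)^+.

    If Y is of class (D), then M <= 1 + Y is uniformly integrable at finite stopping
    times, so the martingale property passes to the limit along a localizing
    sequence, and E[Z] <= sup_t E[X_t] < oo by Fatou. Conversely, if M is a uniformly
    integrable martingale and E[Z] < oo, conditional Jensen gives
    E[(X_T - K)^+] <= E[(Z - K)^+] for T with values in a grid, and Fatou extends this
    to all finite T.

    For the Stieltjes integral, the Riemann sums with M taken at right endpoints have
    expectation exactly E[M_t (C_t - 1)]. Fatou bounds E[int M dC] from above. For the
    other direction no stopping is needed: min(M, K) is a supermartingale, hence the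
    Riemann sums of min(M, K) against min(C, K) have expectation at least
    E[min(M_t, K) (min(C_t, K) - 1)], and they are bounded.

    The almost sure limit M_oo of a nonnegative uniformly integrable martingale comes
    from the convex function 1 / (1 + x): the gaps E[1/(1+M_t)] - E[1/(1+M_s)] tend to
    0, which makes M Cauchy in L1, and Doob's maximal inequality does the rest. *)

Set Implicit Arguments.
Unset Strict Implicit.
Unset Printing Implicit Defensive.

(** Two features of [(x - K)^+] explain its use in place of the tail x 1_{x >= K}: it is convex and
    nondecreasing, hence suited to Jensen and to comparisons such as Y <= M C, and it is continuous,
    hence suited to Fatou. The measurability in w of the pathwise integral int M dC is nowhere
    established. This integral is only compared with measurable bounds, through [le_integral_ge0]:
    integrating a nonnegative function takes a supremum over the simple functions below it, which is
    monotone for arbitrary such functions. A uniformly integrable martingale may have no second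
    moment, so the L2 argument for convergence is replaced by the bounded, strictly convex function
    1 / (1 + x), whose second-order remainder plays the part of the squared increment. Riemann sums
    converge pathwise, but nothing makes them uniformly integrable, so Fatou gives only one
    inequality. Truncating M destroys the martingale property; the supermartingale inequality that
    remains has just the sign needed when M is replaced under the expectation by its final value. *)

Section integrals.
Context {d : measure_display} {T : measurableType d} {R : realType}.
Variable mu : {measure set T -> \bar R}.
Local Open Scope ereal_scope.

(** * Monotonicity, Fatou's lemma and weights measurable for a sub-sigma-algebra *)

Lemma le_integral_ge0 (D : set T) (f g : T -> \bar R) :
  (forall x, D x -> 0 <= f x) -> (forall x, D x -> f x <= g x) ->
  \int[mu]_(x in D) f x <= \int[mu]_(x in D) g x.
Proof.
move=> f0 fg.
have g0 x : D x -> 0 <= g x by move=> Dx; exact: le_trans (f0 _ Dx) (fg _ Dx).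
rewrite !ge0_integralE//; apply: ereal_sup_le => _ [h hf <-].
exists h => // x; apply: le_trans (hf x) _.
by rewrite /patch; case: ifPn => // /set_mem; exact: fg.
Qed.

Lemma limn_einf_le (u : (\bar R)^nat) (B : \bar R) :
  (\forall n \near \oo, u n <= B) -> limn_einf u <= B.
Proof.
move=> [N _ uB]; rewrite limn_einf_lim; apply: lime_le; first exact: is_cvg_einfs.
near=> n; apply: le_trans (uB n _); last by near: n; exists N.
by apply: ereal_inf_lbound; exists n => /=.
Unshelve. all: by end_near. Qed.

Lemma ae_fatou (D : set T) (g : (T -> \bar R)^nat) (f : T -> \bar R) :
  measurable D -> (forall n, measurable_fun D (g n)) ->
  (forall n x, D x -> 0 <= g n x) -> measurable_fun D f ->
  (forall x, D x -> 0 <= f x) ->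
  {ae mu, forall x, D x -> f x <= limn_einf (g ^~ x)} ->
  \int[mu]_(x in D) f x <= limn_einf (fun n => \int[mu]_(x in D) g n x).
Proof.
move=> mD mg g0 mf f0 fg.
have h0 x : D x -> 0 <= limn_einf (g ^~ x).
  move=> Dx; rewrite limn_einf_lim; apply: lime_ge; first exact: is_cvg_einfs.
  by apply: nearW => n; apply: le_ereal_inf_tmp => _ [m /= _ <-]; exact: g0.
have mh : measurable_fun D (fun x => limn_einf (g ^~ x)).
  have -> : (fun x => limn_einf (g ^~ x)) = \- (fun x => limn_esup (\- (g ^~ x))).
    by [].
  apply: measurableT_comp => //.
  apply: (@measurable_fun_limn_esup _ _ _ _ (fun n x => - g n x)) => n.
  exact: measurableT_comp.
apply: (le_trans _ (fatou mu mD mg g0)).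
exact: ae_ge0_le_integral.
Qed.

Lemma fatou_le (D : set T) (g : (T -> \bar R)^nat) (f : T -> \bar R) (B : \bar R) :
  measurable D -> (forall n, measurable_fun D (g n)) ->
  (forall n x, D x -> 0 <= g n x) -> measurable_fun D f ->
  (forall x, D x -> 0 <= f x) ->
  {ae mu, forall x, D x -> f x <= limn_einf (g ^~ x)} ->
  (\forall n \near \oo, \int[mu]_(x in D) g n x <= B) ->
  \int[mu]_(x in D) f x <= B.
Proof.
move=> mD mg g0 mf f0 fg gB.
exact: le_trans (ae_fatou mD mg g0 mf f0 fg) (limn_einf_le gB).
Qed.

Import HBNNSimple.

Lemma integral_mul_indic (A : set T) (U : T -> \bar R) : measurable A ->
  \int[mu]_x ((\1_A x)%:E * U x) = \int[mu]_(x in A) U x.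
Proof.
move=> mA; rewrite [RHS]integral_mkcond; apply: eq_integral => x _.
by rewrite /patch indicE; case: ifPn; rewrite ?mul1e ?mul0e.
Qed.

(* The inequality passes from indicators to simple functions measurable for the
   smaller sigma-algebra, and then to H by monotone convergence. *)
Lemma le_integral_mul (G : set (set T)) (U V : T -> \bar R) (H : T -> R) :
  sigma_algebra setT G -> G `<=` measurable ->
  measurable_fun setT U -> (forall x, 0 <= U x) ->
  measurable_fun setT V -> (forall x, 0 <= V x) ->
  (forall A, G A -> \int[mu]_(x in A) U x <= \int[mu]_(x in A) V x) ->
  measurable_wrt G H -> (forall x, (0 <= H x)%R) ->
  \int[mu]_x ((H x)%:E * U x) <= \int[mu]_x ((H x)%:E * V x).
Proof.
move=> sG Gm mU U0 mV V0 UV mH H0.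
(* [T'] is T equipped with G alone, so the level sets of the simple functions approximating H lie in
   G, where the hypothesis on U and V applies. *)
pose T' := g_sigma_algebraType G.
have mT' : (measurable : set (set T')) = G by exact: sigma_algebra_id.
have GP A : (measurable : set (set T')) A = G A by rewrite mT'.
have mH' : measurable_fun (setT : set T') (EFin \o H : T' -> \bar R).
  apply/measurable_EFinP => _ B mB; rewrite setTI.
  by have := mH B mB; rewrite -GP; exact.
pose h := nnsfun_approx (measurableT : measurable (setT : set T')) mH'.
have hH x : (h n x)%:E @[n --> \oo] --> (H x)%:E.
  by apply: (@cvg_nnsfun_approx _ _ _ _ _ _ mH') => // y _; rewrite lee_fin.
have hle n x : (h n x)%:E <= (H x)%:E.
  have /ereal_nondecreasing_cvgn/(cvg_unique _ (hH x)) -> :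
      nondecreasing_seq (fun n => (h n x)%:E) => //.
    by move=> m p mp; rewrite lee_fin; exact/lefP/nd_nnsfun_approx.
  by apply: ereal_sup_ubound; exists n.
have h0 n x : (0 <= h n x)%R by [].
have mpre n y : G (h n @^-1` [set y]).
  rewrite -GP -[_ @^-1` _]setTI; exact: measurable_funP.
have indic0 n y (x : T) : 0 <= y%:E * (\1_(h n @^-1` [set y]) x)%:E.
  rewrite indicE; case: (boolP (x \in _)) => [/set_mem /= <-|_]; rewrite -EFinM lee_fin ?mulr0//.
  by rewrite mulr1.
have inth n (W : T -> \bar R) : measurable_fun setT W -> (forall x, 0 <= W x) ->
    \int[mu]_x ((h n x)%:E * W x) =
    \sum_(y \in range (h n)) (y%:E * \int[mu]_(x in h n @^-1` [set y]) W x).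
  move=> mW W0.
  transitivity (\int[mu]_x (\sum_(y \in range (h n))
       (y%:E * ((\1_(h n @^-1` [set y]) x)%:E * W x)))).
    apply: eq_integral => x _.
    rewrite (fsbigD1 (h n x))// /= indicE mem_set// mul1e fsbig1 ?adde0//.
    by move=> y [fy /= /nesym yfx]; rewrite indicE memNset ?mul0e ?mule0.
  have mI y : measurable_fun setT (fun x : T => (\1_(h n @^-1` [set y]) x)%:E * W x).
    have /measurable_EFinP m1 : measurable_fun setT (\1_(h n @^-1` [set y]) : T -> R).
      by apply: measurable_indic; exact: Gm.
    exact: emeasurable_funM m1 mW.
  rewrite ge0_integral_fsum//.
  - apply: eq_fsbigr => y /set_mem [x _ <-].
    rewrite ge0_integralZl ?lee_fin//; last first.
      by move=> z _; rewrite mule_ge0// lee_fin indicE.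
    by rewrite integral_mul_indic//; exact: Gm.
  - by move=> y; exact: measurable_funeM.
  - by move=> y x _; rewrite muleA mule_ge0.
have hUV n : \int[mu]_x ((h n x)%:E * U x) <= \int[mu]_x ((H x)%:E * V x).
  apply: (@le_trans _ _ (\int[mu]_x ((h n x)%:E * V x))); last first.
    apply: le_integral_ge0 => x _; first by rewrite mule_ge0// lee_fin.
    by rewrite lee_wpmul2r.
  rewrite !inth// !fsbig_finite//= big_seq [leRHS]big_seq.
  apply: lee_sum => y; rewrite in_fset_set// => /set_mem[x _ <-].
  by rewrite lee_wpmul2l ?lee_fin//; exact: UV.
have mh n : measurable_fun setT (EFin \o h n : T -> \bar R).
  apply/measurable_EFinP => _ B mB.
  by rewrite setTI; apply: Gm; rewrite -GP -[_ @^-1` _]setTI; exact: measurable_funP.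
have mHT : measurable_fun setT (EFin \o H).
  apply/measurable_EFinP => _ B mB; rewrite setTI; apply: Gm; exact: mH.
apply: (@fatou_le _ (fun n x => (h n x)%:E * U x)) => //.
- by move=> n; apply: emeasurable_funM => //; exact: mh.
- by move=> n x _; rewrite mule_ge0// lee_fin.
- exact: emeasurable_funM.
- by move=> x _; rewrite mule_ge0// lee_fin.
- apply: aeW => x _.
  (* [U x] may be infinite, and 0 * oo breaks the continuity of the product. If [H x = 0], the
     approximations from below vanish too, and the sequence of products is constant. *)
  have [Hx0|Hx0] := eqVneq (H x) 0%R.
    rewrite Hx0 mul0e (_ : (fun n => _) = cst 0) ?limn_einf_lim ?lim_cst//.
      by rewrite -limn_einf_lim (cvg_limn_einf_sup (cvg_cst _)).1.
    apply/funext => n /=; suff -> : h n x = 0%R by rewrite mul0e.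
    by apply/eqP; rewrite eq_le h0 andbT -lee_fin -Hx0.
  have /cvg_limn_einf_sup[-> _]// : (h n x)%:E * U x @[n --> \oo] --> (H x)%:E * U x.
  apply: cvgeM (hH x) (cvg_cst _).
  have [Ux|Ux] := boolP (U x \is a fin_num); first exact: mule_def_fin.
  exact: mule_def_neq0_infty.
- by apply: nearW => n; exact: hUV.
Qed.

End integrals.

(** * Excess over a level and uniform integrability *)

Section excess.
Context {R : realType}.
Local Open Scope ereal_scope.
Implicit Types (K : R) (x y : \bar R).

Definition excess K x : \bar R := maxe (x - K%:E) 0.

Lemma excess_ge0 K x : 0 <= excess K x.
Proof. by rewrite /excess le_max lexx orbT. Qed.

Lemma excessEFin K (r : R) : excess K r%:E = (Num.max (r - K) 0)%:E.
Proof. by rewrite /excess -EFinB EFin_max. Qed.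

Lemma le_excess K x y : x <= y -> excess K x <= excess K y.
Proof. by move=> xy; apply: le_max2 => //; exact: leeB. Qed.

Lemma mine_excess K x : mine x K%:E + excess K x = x.
Proof.
case: x => [r| |].
- rewrite excessEFin -EFin_min -EFinD; congr EFin.
  by rewrite /Num.min /Num.max; case: ltP => ?; case: ltP => ?; lra.
- by rewrite /excess min_r ?leey// addye// max_l ?leey.
- by rewrite /excess min_l ?leNye.
Qed.

Lemma le_cst_excess K x : x <= K%:E + excess K x.
Proof. by rewrite -{1}(mine_excess K x) leeD2r// ge_min lexx orbT. Qed.

Lemma measurable_excess d (T : measurableType d) K (D : set T) (f : T -> \bar R) :
  measurable_fun D f -> measurable_fun D (fun w => excess K (f w)).
Proof.
by move=> mf; apply: measurable_maxe => //; exact: emeasurable_funB.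
Qed.

Lemma cvge_EFin_comp (phi : \bar R -> \bar R) (h : R -> R) (u : (\bar R)^nat) (r : R) :
  (forall s : R, phi s%:E = (h s)%:E) -> {for r, continuous h} ->
  u n @[n --> \oo] --> r%:E -> phi (u n) @[n --> \oo] --> phi r%:E.
Proof.
move=> phiE ch /fine_cvgP[ufin ur]; rewrite phiE.
apply: (@cvg_trans _ ((h (fine (u n)))%:E @[n --> \oo])).
  by apply: near_eq_cvg; near=> n; rewrite -phiE fineK//; near: n.
by apply: cvg_EFin; [exact: nearW|exact: cvg_comp ur ch].
Unshelve. all: by end_near. Qed.

Lemma cvg_mine K (u : (\bar R)^nat) l : 0 <= l ->
  u n @[n --> \oo] --> l -> mine (u n) K%:E @[n --> \oo] --> mine l K%:E.
Proof.
case: l => [r| |]// _ ul.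
- apply: (@cvge_EFin_comp (fun x => mine x K%:E) (fun s : R => Num.min s K)) => //.
    by move=> x; rewrite EFin_min.
  by apply: (@continuous_min R R id (cst K)) => //; exact: cvg_cst.
- rewrite min_r ?leey//; apply: cvg_near_cst.
  move/cvgeyPge : ul => /(_ K); apply: filterS => n Kn.
  by rewrite min_r.
Qed.

Lemma cvg_excess K (u : (\bar R)^nat) l : 0 <= l ->
  u n @[n --> \oo] --> l -> excess K (u n) @[n --> \oo] --> excess K l.
Proof.
case: l => [r| |]// _ ul.
- apply: (@cvge_EFin_comp (excess K) (fun s : R => Num.max (s - K) 0)%R) => //.
    exact: excessEFin.
  apply: (@continuous_max R R (fun s : R => s - K)%R (cst 0%R)) => //; last exact: cvg_cst.
  by apply: cvgB; [exact: cvg_id|exact: cvg_cst].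
- rewrite /excess max_l ?leey//; apply/cvgeyPge => A.
  move/cvgeyPge : ul => /(_ (A + K)%R); apply: filterS => n An.
  by rewrite le_max leeBrDr// An.
Qed.

End excess.

Section uniform_integrability.
Context {d : measure_display} {T : measurableType d} {R : realType}.
Variable P : probability T R.
Local Open Scope ereal_scope.

Definition small_excess (H : set (T -> R)) := forall e : R, (0 < e)%R ->
  exists2 K : R, (0 <= K)%R &
    forall Z, H Z -> \int[P]_w excess K (Z w)%:E <= e%:E.

(** For K >= 0, (Z - K)^+ is at most Z on K <= Z and zero elsewhere. Conversely Z <= 2 (Z - K) on 2
    K <= Z, which is the origin of the levels [2 * K] and [e / 2]. *)
Lemma uniformly_integrableP (H : set (T -> R)) :
  (forall Z, H Z -> measurable_fun setT Z) ->
  (forall Z w, H Z -> (0 <= Z w)%R) ->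
  uniformly_integrable P H <-> small_excess H.
Proof.
move=> mH H0; split=> [[_ UI] e e0|sH].
  have [K hK] := UI e e0; exists (Num.max K 0)%R; first by rewrite le_max lexx orbT.
  move=> Z HZ; apply: le_trans (hK Z HZ).
  rewrite [leRHS]integral_mkcond; apply: le_integral_ge0 => w _.
    exact: excess_ge0.
  rewrite excessEFin /patch; case: ifPn => [/set_mem /= KZ|/negP KZ].
    by rewrite lee_fin ger0_norm ?H0// ge_max H0// andbT lerBlDr lerDl le_max lexx orbT.
  rewrite lee_fin ge_max lexx andbT subr_le0 le_max.
  by apply/orP; left; apply/ltW; rewrite ltNge; apply/negP => KZ'; apply: KZ;
    apply/mem_set; rewrite /= ger0_norm ?H0.
split=> // e e0; have [|K K0 hK] := sH (e / 2)%R; first by rewrite divr_gt0.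
exists (2 * K)%R => Z HZ.
have mZ := mH _ HZ.
apply: (@le_trans _ _ (\int[P]_w (2%:E * excess K (Z w)%:E))); last first.
  rewrite ge0_integralZl//; first last.
  - by move=> w _; exact: excess_ge0.
  - by apply: measurable_excess; exact/measurable_EFinP.
  rewrite (_ : e%:E = 2%:E * (e / 2)%:E); last by rewrite -EFinM mulrC divfK.
  by apply: lee_wpmul2l => //; exact: hK.
rewrite [leLHS]integral_mkcond; apply: le_integral_ge0 => w _.
  by rewrite /patch; case: ifPn => // _; rewrite lee_fin.
rewrite /patch; case: ifPn => [/set_mem /= KZ|_]; last first.
  by rewrite mule_ge0// excess_ge0.
rewrite ger0_norm ?H0// in KZ *; rewrite excessEFin -EFinM lee_fin.
have : (Z w - K <= Num.max (Z w - K) 0)%R by rewrite le_max lexx.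
lra.
Qed.

(* Cutting at the level K costs at most e uniformly in n, and the truncated
   variables converge by bounded convergence. *)
Lemma vitali (U : nat -> T -> R) (V : T -> \bar R) (A : set T) :
  (forall n, measurable_fun setT (U n)) -> (forall n w, (0 <= U n w)%R) ->
  measurable_fun setT V -> (forall w, 0 <= V w) ->
  {ae P, forall w, (U n w)%:E @[n --> \oo] --> V w} ->
  small_excess (range U) -> measurable A ->
  \int[P]_(w in A) (U n w)%:E @[n --> \oo] --> \int[P]_(w in A) V w.
Proof.
move=> mU U0 mV V0 UV sU mA.
have mUE n : measurable_fun setT (fun w => (U n w)%:E) by exact/measurable_EFinP.
have mUA n : measurable_fun A (fun w => (U n w)%:E) by exact: measurable_funTS.
have mVA : measurable_fun A V by exact: measurable_funTS.
have key e : (0 < e)%R -> exists K : R, [/\ (0 <= K)%R,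
    forall n, \int[P]_(w in A) (U n w)%:E <= \int[P]_(w in A) mine (U n w)%:E K%:E + e%:E &
    \int[P]_(w in A) V w <= \int[P]_(w in A) mine (V w) K%:E + e%:E].
  move=> e0; have [K K0 hK] := sU e e0; exists K.
  have split (W : T -> \bar R) : measurable_fun A W -> (forall w, 0 <= W w) ->
     \int[P]_(w in A) excess K (W w) <= e%:E ->
     \int[P]_(w in A) W w <= \int[P]_(w in A) mine (W w) K%:E + e%:E.
    move=> mW W0 We; under eq_integral do rewrite -{1}(mine_excess K (W _)).
    rewrite ge0_integralD//.
    - exact: leeD2l.
    - by move=> w _; rewrite le_min W0 lee_fin.
    - exact: measurable_mine.
    - by move=> w _; exact: excess_ge0.
    - exact: measurable_excess.
  have exA n : \int[P]_(w in A) excess K (U n w)%:E <= e%:E.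
    apply: le_trans (hK (U n) _); last by exists n.
    apply: ge0_subset_integral => //; first exact: measurable_excess.
    by move=> w _; exact: excess_ge0.
  split=> // [n|].
    by apply: split => // w; rewrite lee_fin.
  apply: split => //.
  apply: (@fatou_le _ _ _ _ _ (fun n w => excess K (U n w)%:E)) => //.
  - by move=> n; exact: measurable_excess.
  - by move=> n w _; exact: excess_ge0.
  - exact: measurable_excess.
  - by move=> w _; exact: excess_ge0.
  - apply: filterS UV => w UVw _.
    by have [->] := cvg_limn_einf_sup (cvg_excess (K := K) (V0 w) UVw).
  - by apply: nearW => n; exact: exA.
have mine_fin K (W : T -> \bar R) : (0 <= K)%R -> measurable_fun A W -> (forall w, 0 <= W w) ->
    \int[P]_(w in A) mine (W w) K%:E \is a fin_num.
  move=> K0 mW W0; rewrite ge0_fin_numE; last first.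
    by apply: integral_ge0 => w _; rewrite le_min W0 lee_fin.
  apply: (@le_lt_trans _ _ (\int[P]_(w in A) cst K%:E w)).
    apply: le_integral_ge0 => w _; first by rewrite le_min W0 lee_fin.
    by rewrite ge_min lexx orbT.
  by rewrite integral_cst// lte_mul_pinfty// (le_lt_trans (probability_le1 P mA))// ltry.
have le_mine K (W : T -> \bar R) : (0 <= K)%R -> (forall w, 0 <= W w) ->
    \int[P]_(w in A) mine (W w) K%:E <= \int[P]_(w in A) W w.
  move=> K0 W0; apply: le_integral_ge0 => w _; first by rewrite le_min W0 lee_fin.
  by rewrite ge_min lexx.
have Vfin : \int[P]_(w in A) V w \is a fin_num.
  have [K [K0 _ hV]] := key 1%R ltr01.
  rewrite ge0_fin_numE ?integral_ge0//; apply: le_lt_trans hV _.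
  by rewrite ltey_eq fin_numD mine_fin.
have Ufin n : \int[P]_(w in A) (U n w)%:E \is a fin_num.
  have [K [K0 hU _]] := key 1%R ltr01.
  rewrite ge0_fin_numE; last by apply: integral_ge0 => w _; rewrite lee_fin.
  apply: le_lt_trans (hU n) _.
  by rewrite ltey_eq fin_numD mine_fin// => w; rewrite lee_fin.
rewrite -(fineK Vfin); apply/fine_cvgP; split; first exact: nearW.
apply/cvgrPdist_le => e e0.
have e2 : (0 < e / 2)%R by rewrite divr_gt0.
have [K [K0 hU hV]] := key _ e2.
have mineK w x : (0 <= x)%E -> `|mine x K%:E| <= cst K%:E w.
  by move=> x0; rewrite gee0_abs ?ge_min ?lexx ?orbT// le_min x0 lee_fin.
have [|||||_ _] := @dominated_convergence _ _ _ P A mA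
    (fun n w => mine (U n w)%:E K%:E) (fun w => mine (V w) K%:E) (cst K%:E).
- by move=> n; exact: measurable_mine.
- exact: measurable_mine.
- by apply: filterS UV => w UVw _; exact: cvg_mine.
- exact: finite_measure_integrable_cst.
- by apply: aeW => w n _; apply: mineK; rewrite lee_fin.
rewrite -(fineK (mine_fin K V K0 mVA V0)) => /fine_cvgP[_ /cvgrPdist_le/(_ _ e2)].
apply: filterS => n /=.
have UE0 w : 0 <= (U n w)%:E by rewrite lee_fin.
have := hU n; have := le_mine K _ K0 UE0; have := le_mine K _ K0 V0; have := hV.
have := mine_fin K _ K0 (mUA n) UE0; have := mine_fin K _ K0 mVA V0.
have := Ufin n; have := Vfin.
case: (\int[P]_(w in A) V w) => // v _.
case: (\int[P]_(w in A) (U n w)%:E) => // u _.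
case: (\int[P]_(w in A) mine (V w) K%:E) => // b _.
case: (\int[P]_(w in A) mine (U n w)%:E K%:E) => // c _.
rewrite -!EFinD !lee_fin /= => *; rewrite ler_norml.
have : (- (e / 2) <= b - c <= e / 2)%R by rewrite -ler_norml.
by move=> /andP[? ?]; apply/andP; split; lra.
Qed.

End uniform_integrability.

(** * Martingale inequalities in L1 *)

Section measurable_wrt.
Context {d : measure_display} {T : measurableType d} {R : realType}.
Variables (G : set (set T)) (sG : sigma_algebra setT G).

Lemma g_sigma_measurableE (A : set T) :
  (measurable : set (set (g_sigma_algebraType G))) A = G A.
Proof. by have /(congr1 (fun f => f A)) := sigma_algebra_id sG. Qed.

(** Transports G-measurability to a measurable type carrying G, so that closure under arithmetic and
    comparison comes from the general theory. *)
Lemma measurable_wrtP (Z : T -> R) : measurable_wrt G Z <->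
  measurable_fun (setT : set (g_sigma_algebraType G)) Z.
Proof.
split=> mZ.
  by move=> _ B mB; rewrite setTI g_sigma_measurableE; exact: mZ.
move=> B mB; rewrite -g_sigma_measurableE -[_ @^-1` _]setTI.
exact: mZ.
Qed.

Lemma measurable_wrt_le (X Y : T -> R) :
  measurable_wrt G X -> measurable_wrt G Y -> G [set w | X w <= Y w].
Proof.
move=> /measurable_wrtP mX /measurable_wrtP mY.
rewrite -g_sigma_measurableE -[X in measurable X]setTI.
exact: (measurable_fun_ler mX mY measurableT (Y := [set true])).
Qed.

Lemma measurable_wrt_lt (X Y : T -> R) :
  measurable_wrt G X -> measurable_wrt G Y -> G [set w | X w < Y w].
Proof.
move=> /measurable_wrtP mX /measurable_wrtP mY.
rewrite -g_sigma_measurableE -[X in measurable X]setTI.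
exact: (measurable_fun_ltr mX mY measurableT (Y := [set true])).
Qed.

Lemma measurable_wrt_cst (r : R) : measurable_wrt G (fun=> r).
Proof. by apply/measurable_wrtP; exact: measurable_cst. Qed.

Lemma sigma_setU (A B : set T) : G A -> G B -> G (A `|` B).
Proof. by rewrite -!g_sigma_measurableE; exact: measurableU. Qed.

Lemma sigma_setI (A B : set T) : G A -> G B -> G (A `&` B).
Proof. by rewrite -!g_sigma_measurableE; exact: measurableI. Qed.

Lemma sigma_setD (A B : set T) : G A -> G B -> G (A `\` B).
Proof. by rewrite -!g_sigma_measurableE; exact: measurableD. Qed.

End measurable_wrt.

Section martingale.
Context {d : measure_display} {T : measurableType d} {R : realType}.
Variables (P : probability T R) (F : R -> set (set T)).
Hypothesis filF : filtration F.

Lemma filtration_sigma t : 0 <= t -> sigma_algebra setT (F t).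
Proof. by move=> t0; have [] := filF.1 t t0. Qed.

Lemma filtration_measurable t : 0 <= t -> F t `<=` measurable.
Proof. by move=> t0; have [] := filF.1 t t0. Qed.

Lemma filtration_le s t : 0 <= s -> s <= t -> F s `<=` F t.
Proof. exact: filF.2. Qed.

Lemma measurable_wrt_mon s t (Z : T -> R) : 0 <= s -> s <= t ->
  measurable_wrt (F s) Z -> measurable_wrt (F t) Z.
Proof. by move=> s0 st mZ B mB; apply: (filtration_le s0 st); exact: mZ. Qed.

Lemma measurable_wrt_fun t (Z : T -> R) : 0 <= t ->
  measurable_wrt (F t) Z -> measurable_fun setT Z.
Proof.
move=> t0 mZ _ B mB; rewrite setTI; apply: (filtration_measurable t0).
exact: mZ.
Qed.

Variable M : R -> T -> R.
Hypothesis martM : martingale P F M.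
Hypothesis M_ge0 : forall t w, 0 <= t -> 0 <= M t w.

Let mM t : 0 <= t -> measurable_fun setT (M t).
Proof. by have [aM _ _] := martM => t0; exact: measurable_wrt_fun t0 (aM _ t0). Qed.

Let mME t : 0 <= t -> measurable_fun setT (EFin \o M t).
Proof. by move=> t0; apply/measurable_EFinP; exact: mM. Qed.

Lemma martingale_integral s t A : 0 <= s -> s <= t -> F s A ->
  (\int[P]_(w in A) (M s w)%:E = \int[P]_(w in A) (M t w)%:E)%E.
Proof. by move=> s0 st FA; have [_ _ /(_ _ _ s0 st)[_ _]] := martM; apply. Qed.

(** Both sides may be infinite, so equality is obtained as two inequalities between nonnegative
    integrals, without any subtraction. *)
Lemma martingale_mul s t (H : T -> R) : 0 <= s -> s <= t ->
  measurable_wrt (F s) H -> (forall w, 0 <= H w) ->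
  (\int[P]_w ((H w)%:E * (M s w)%:E) = \int[P]_w ((H w)%:E * (M t w)%:E))%E.
Proof.
move=> s0 st mH H0; have t0 := le_trans s0 st.
have sF := filtration_sigma s0; have mF := filtration_measurable s0.
apply/eqP; rewrite eq_le; apply/andP; split; apply: le_integral_mul sF mF _ _ _ _ _ mH H0 => //.
- exact: mME.
- by move=> w; rewrite lee_fin M_ge0.
- exact: mME.
- by move=> w; rewrite lee_fin M_ge0.
- by move=> A FA; rewrite (martingale_integral s0 st FA).
- exact: mME.
- by move=> w; rewrite lee_fin M_ge0.
- exact: mME.
- by move=> w; rewrite lee_fin M_ge0.
- by move=> A FA; rewrite (martingale_integral s0 st FA).
Qed.

Let inv1 t w := (1 + M t w)^-1.
(** With x = M_s and y = M_t this is an exact Taylor remainder: 1/(1+y) - 1/(1+x) + (y-x)/(1+x)^2 =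
    (y-x)^2 / ((1+x)^2 (1+y)). *)
Let gap s t w := (M t w - M s w) ^+ 2 * inv1 s w ^+ 2 * inv1 t w.

Let inv1_ge0 t w : 0 <= t -> 0 <= inv1 t w.
Proof. by move=> t0; rewrite invr_ge0 addr_ge0 ?M_ge0. Qed.

Let gap_ge0 s t w : 0 <= s -> 0 <= t -> 0 <= gap s t w.
Proof.
move=> s0 t0; apply: mulr_ge0; last exact: inv1_ge0.
by apply: mulr_ge0; exact: sqr_ge0.
Qed.

Let minv1 t : 0 <= t -> measurable_wrt (F t) (inv1 t).
Proof.
move=> t0; have [aM _ _] := martM; have sF := filtration_sigma t0.
apply/(measurable_wrtP sF).
rewrite (_ : inv1 t = (fun w => (1 + M t w) `^ (-1))); last first.
  by apply/funext => w; rewrite powR_inv1// addr_ge0// M_ge0.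
apply: (measurableT_comp (measurable_powR _)); apply: measurable_funD => //.
exact/(measurable_wrtP sF)/aM.
Qed.

(* Second-order Taylor expansion of x |-> 1 / (1 + x), whose linear term has zero
   expectation. *)
Let integral_gap s t : 0 <= s -> s <= t ->
  (\int[P]_w (gap s t w)%:E + \int[P]_w (inv1 s w)%:E =
   \int[P]_w (inv1 t w)%:E)%E.
Proof.
move=> s0 st; have t0 := le_trans s0 st.
have mi u : 0 <= u -> measurable_fun setT (inv1 u).
  by move=> u0; exact: measurable_wrt_fun u0 (minv1 u0).
have mi2 : measurable_fun setT (fun w => inv1 s w ^+ 2).
  by apply: measurable_funX; exact: mi.
have mg : measurable_fun setT (gap s t).
  apply: measurable_funM; last exact: mi.
  apply: measurable_funM => //; apply: measurable_funX.
  by apply: measurable_funB; exact: mM.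
have hM : (\int[P]_w ((inv1 s w ^+ 2)%:E * (M s w)%:E) =
           \int[P]_w ((inv1 s w ^+ 2)%:E * (M t w)%:E))%E.
  apply: martingale_mul => //; last by move=> w; exact: sqr_ge0.
  have sF := filtration_sigma s0.
  by apply/(measurable_wrtP sF)/measurable_funX/(measurable_wrtP sF)/minv1.
(* Since x / (1 + x)^2 <= 1, the linear term is finite and can be cancelled at the end. *)
have hfin : (\int[P]_w ((inv1 s w ^+ 2)%:E * (M s w)%:E) \is a fin_num)%E.
  rewrite ge0_fin_numE; last first.
    by apply: integral_ge0 => w _; rewrite -EFinM lee_fin mulr_ge0 ?sqr_ge0 ?M_ge0.
  apply: (@le_lt_trans _ _ (\int[P]_w cst 1%:E w)%E); last first.
    by rewrite integral_cst// mul1e (le_lt_trans (probability_le1 P measurableT))// ltry.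
  apply: le_integral_ge0 => w _.
    by rewrite -EFinM lee_fin mulr_ge0 ?sqr_ge0 ?M_ge0.
  have := M_ge0 w s0; rewrite -EFinM lee_fin /inv1 exprVn => M0.
  rewrite mulrC ler_pdivrMr ?exprn_gt0 ?ltr_wpDr//; nra.
(* The Taylor identity is arranged so that every term is nonnegative and the integrals add up in the
   extended reals. *)
have h : (\int[P]_w (gap s t w)%:E + \int[P]_w (inv1 s w)%:E +
        \int[P]_w ((inv1 s w ^+ 2)%:E * (M s w)%:E) =
        \int[P]_w (inv1 t w)%:E + \int[P]_w ((inv1 s w ^+ 2)%:E * (M t w)%:E))%E.
  have m1 : measurable_fun setT (fun w => (gap s t w)%:E) by exact/measurable_EFinP.
  have m2 u : 0 <= u -> measurable_fun setT (fun w => (inv1 u w)%:E).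
    by move=> u0; exact/measurable_EFinP/mi.
  have m3 u : 0 <= u -> measurable_fun setT (fun w => (inv1 s w ^+ 2)%:E * (M u w)%:E)%E.
    by move=> u0; apply/measurable_EFinP/measurable_funM => //; exact: mM.
  have p1 w : (0 <= (gap s t w)%:E)%E by rewrite lee_fin gap_ge0.
  have p2 u w : 0 <= u -> (0 <= (inv1 u w)%:E)%E by move=> u0; rewrite lee_fin inv1_ge0.
  have p3 u w : 0 <= u -> (0 <= (inv1 s w ^+ 2)%:E * (M u w)%:E)%E.
    by move=> u0; rewrite -EFinM lee_fin mulr_ge0 ?sqr_ge0 ?M_ge0.
  rewrite -[in LHS]ge0_integralD//; [|by move=> w _; exact: p2|exact: m2].
  rewrite -ge0_integralD//; first last.
  - exact: m3.
  - by move=> w _; exact: p3.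
  - by apply: emeasurable_funD => //; exact: m2.
  - by move=> w _; rewrite adde_ge0 ?p2.
  rewrite -ge0_integralD//; first last.
  - exact: m3.
  - by move=> w _; exact: p3.
  - exact: m2.
  - by move=> w _; exact: p2.
  apply: eq_integral => w _; rewrite -!EFinM -!EFinD; congr EFin.
  have := M_ge0 w s0; have := M_ge0 w t0.
  rewrite /gap /inv1 => Mt0 Ms0.
  by field; rewrite !gt_eqF// ltr_wpDr.
by rewrite -[LHS](addeK _ hfin) h hM addeK// -hM.
Qed.

(** If one of the two values exceeds 2 K, the larger one, x say, bounds the increment and satisfies
    x <= 2 (x - K). Otherwise (1 + M_s)^2 (1 + M_t) <= (1 + 2 K)^3, and the increment r satisfies
    |r| <= dlt + r^2 / dlt. *)
Let gap_bound (K dlt : R) s t w : 0 <= s -> 0 <= t -> 0 <= K -> 0 < dlt ->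
  (`|M t w - M s w|%:E <= dlt%:E + ((1 + 2 * K) ^+ 3 / dlt)%:E * (gap s t w)%:E +
     (2%:E * excess K (M s w)%:E + 2%:E * excess K (M t w)%:E))%E.
Proof.
move=> s0 t0 K0 dlt0; rewrite !excessEFin -!EFinM -!EFinD lee_fin.
have g0 : 0 <= (1 + 2 * K) ^+ 3 / dlt * gap s t w.
  by rewrite mulr_ge0 ?gap_ge0// divr_ge0 ?(ltW dlt0)// exprn_ge0 ?addr_ge0 ?mulr_ge0.
have := M_ge0 w s0; have := M_ge0 w t0.
move: g0; rewrite /gap /inv1; move: (M s w) (M t w) => a b g0 b0 a0.
have ea : a - K <= Num.max (a - K) 0 by rewrite le_max lexx.
have eb : b - K <= Num.max (b - K) 0 by rewrite le_max lexx.
have ea0 : 0 <= Num.max (a - K) 0 by rewrite le_max lexx orbT.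
have eb0 : 0 <= Num.max (b - K) 0 by rewrite le_max lexx orbT.
have [bK|bK] := ltP (2 * K) b.
  by have [ab|ab] := lerP a b; lra.
have [aK|aK] := ltP (2 * K) a.
  by have [ab|ab] := lerP a b; lra.
suff : `|b - a| <= dlt + (1 + 2 * K) ^+ 3 / dlt * ((b - a) ^+ 2 * (1 + a)^-1 ^+ 2 * (1 + b)^-1).
  lra.
apply: (@le_trans _ _ (dlt + (b - a) ^+ 2 / dlt)).
  rewrite (_ : dlt + _ = (dlt ^+ 2 + (b - a) ^+ 2) / dlt); last by field; rewrite gt_eqF.
  rewrite ler_pdivlMr// -(real_normK (num_real (b - a))).
  by have := sqr_ge0 (`|b - a| - dlt); have := normr_ge0 (b - a); nra.
rewrite lerD2l (_ : _ * (_ * _ * _) = (b - a) ^+ 2 / dlt *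
    ((1 + 2 * K) ^+ 3 / ((1 + a) ^+ 2 * (1 + b)))); last first.
  by field; rewrite !gt_eqF// ltr_wpDr.
have ab0 : 0 < (1 + a) ^+ 2 * (1 + b) by rewrite mulr_gt0 ?exprn_gt0// ltr_wpDr.
rewrite ler_peMr ?divr_ge0 ?sqr_ge0 ?(ltW dlt0)// ler_pdivlMr// mul1r.
rewrite [leRHS]exprSr; apply: ler_pM; rewrite ?exprn_ge0 ?addr_ge0//; last lra.
by rewrite lerXn2r ?nnegrE ?addr_ge0 ?mulr_ge0// lerD2l.
Qed.

Hypothesis sE : small_excess P [set M t | t in `[0, +oo[].

Lemma martingale_cauchy_L1 e : 0 < e -> exists2 s, 0 <= s &
  forall t, s <= t -> (\int[P]_w `|M t w - M s w|%:E <= e%:E)%E.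
Proof.
move=> e0; have [|K K0 hK] := sE (e := e / 16); first by rewrite divr_gt0.
have dlt0 : 0 < e / 4 by rewrite divr_gt0.
set dlt := e / 4 in dlt0; pose c := (1 + 2 * K) ^+ 3 / dlt.
have c0 : 0 < c by rewrite divr_gt0// exprn_gt0// ltr_wpDr// mulr_ge0.
have u01 t : 0 <= t -> (0 <= \int[P]_w (inv1 t w)%:E <= 1%:E)%E.
  move=> t0; rewrite integral_ge0/=; last by move=> w _; rewrite lee_fin inv1_ge0.
  apply: (@le_trans _ _ (\int[P]_w cst 1%:E w)%E); last first.
    by rewrite integral_cst// mul1e probability_le1.
  apply: le_integral_ge0 => w _; rewrite lee_fin ?inv1_ge0//.
  by rewrite invf_le1 ?ltr_wpDr ?lerDl ?M_ge0.
have ufin t : 0 <= t -> (\int[P]_w (inv1 t w)%:E \is a fin_num)%E.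
  by move=> t0; have /andP[u0 u1] := u01 t t0;
    rewrite ge0_fin_numE// (le_lt_trans u1)// ltry.
(* By [integral_gap] the expectations of [inv1 t] are nondecreasing in t, and they are at most 1. A
   time s that nearly attains their supremum controls all later gaps at once. *)
pose S := [set fine (\int[P]_w (inv1 t w)%:E)%E | t in `[0, +oo[].
have supS : has_sup S.
  split; first by exists (fine (\int[P]_w (inv1 0 w)%:E)%E), 0 => //=; rewrite in_itv/= lexx.
  exists 1 => y [t /=]; rewrite in_itv/= andbT => t0 <-.
  by rewrite -lee_fin fineK ?ufin//; have /andP[] := u01 t t0.
have [|y [s /=]] := @sup_adherent _ S (dlt / c) _ supS; first by rewrite divr_gt0.
rewrite in_itv/= andbT => s0 <- us; exists s => // t st.
have t0 := le_trans s0 st.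
have mg : measurable_fun setT (fun w => (gap s t w)%:E).
  apply/measurable_EFinP/measurable_funM; last exact: measurable_wrt_fun t0 (minv1 t0).
  apply: measurable_funM; apply: measurable_funX; last exact: measurable_wrt_fun s0 (minv1 s0).
  by apply: measurable_funB; exact: mM.
have gp w : (0 <= (gap s t w)%:E)%E by rewrite lee_fin gap_ge0.
have gle : (\int[P]_w (gap s t w)%:E <= (dlt / c)%:E)%E.
  have := integral_gap s0 st.
  have : (\int[P]_w (inv1 t w)%:E <= (sup S)%:E)%E.
    rewrite -(fineK (ufin _ t0)) lee_fin; apply: ub_le_sup; first exact: supS.2.
    by exists t => //=; rewrite in_itv/= andbT.
  move: us; rewrite -lte_fin fineK ?ufin//.
  have := ufin _ s0; have := ufin _ t0.
  have : (0 <= \int[P]_w (gap s t w)%:E)%E by exact: integral_ge0.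
  case: (\int[P]_w (inv1 s w)%:E)%E => // a.
  case: (\int[P]_w (inv1 t w)%:E)%E => // b.
  case: (\int[P]_w (gap s t w)%:E)%E => // r _ _ _.
  by rewrite lte_fin !lee_fin -EFinD => ? ? [?]; lra.
have mx u : 0 <= u -> measurable_fun setT (fun w => 2%:E * excess K (M u w)%:E)%E.
  by move=> u0; apply/measurable_funeM/measurable_excess/measurable_EFinP/mM.
have px u w : (0 <= 2%:E * excess K (M u w)%:E)%E by rewrite mule_ge0 ?excess_ge0.
apply: (@le_trans _ _ (\int[P]_w (dlt%:E + c%:E * (gap s t w)%:E +
     (2%:E * excess K (M s w)%:E + 2%:E * excess K (M t w)%:E)))%E).
  by apply: le_integral_ge0 => w _; [rewrite lee_fin|exact: gap_bound].
have cg w : (0 <= c%:E * (gap s t w)%:E)%E by rewrite mule_ge0// lee_fin ltW.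
have mcg : measurable_fun setT (fun w => c%:E * (gap s t w)%:E)%E by exact: measurable_funeM.
rewrite ge0_integralD//; first last.
- by apply: emeasurable_funD; exact: mx.
- by move=> w _; rewrite adde_ge0.
- exact: emeasurable_funD.
- by move=> w _; rewrite adde_ge0// lee_fin ltW.
rewrite ge0_integralD//; last by move=> w _; rewrite lee_fin ltW.
rewrite ge0_integralD//; [|exact: mx|exact: mx].
(* Budget: [dlt = e / 4] for the constant, [dlt] for [c] times the gap, e / 8 for each excess; the
   last [dlt] is slack. *)
rewrite (_ : e%:E = dlt%:E + dlt%:E + ((2 * (e / 16))%:E + (2 * (e / 16))%:E) +
    dlt%:E)%E; last by rewrite -!EFinD; congr EFin; rewrite /dlt; lra.
have intx u : 0 <= u -> (\int[P]_w (2%:E * excess K (M u w)%:E) <= (2 * (e / 16))%:E)%E.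
  move=> u0; rewrite ge0_integralZl//.
  - rewrite EFinM lee_wpmul2l//; apply: hK; exists u => //=.
    by rewrite in_itv/= andbT.
  - exact/measurable_excess/measurable_EFinP/mM.
  - by move=> w _; exact: excess_ge0.
rewrite -[leLHS]adde0; apply: leeD; last by rewrite lee_fin ltW.
apply: leeD; last by apply: leeD; exact: intx.
apply: leeD.
  by rewrite integral_cst//= -[leRHS]mule1 lee_wpmul2l ?probability_le1// lee_fin ltW.
rewrite ge0_integralZl//; last by rewrite lee_fin ltW.
rewrite (_ : dlt%:E = (c%:E * (dlt / c)%:E)%E); last first.
  by rewrite -EFinM mulrC divfK// gt_eqF.
by rewrite lee_wpmul2l// lee_fin ltW.
Qed.

End martingale.

(** * Almost sure convergence of uniformly integrable martingales *)

Section grid.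
Context {R : realType}.

Definition grid n i : R := i%:R / n.+1%:R.

Definition grid_index n (u : R) : nat := `|Num.ceil (u * n.+1%:R)|.

Lemma grid0 n : grid n 0 = 0.
Proof. by rewrite /grid mul0r. Qed.

Lemma grid_ge0 n i : 0 <= grid n i.
Proof. by rewrite divr_ge0. Qed.

Lemma grid_mono n : {mono grid n : i j / (i <= j)%N >-> i <= j}.
Proof. by move=> i j; rewrite /grid ler_pM2r ?invr_gt0// ler_nat. Qed.

(** Rounding is upwards, so for a stopping time the event that the rounded time is at most
    [grid n k] is the event that the time itself is, and is known at that time. *)
Lemma grid_index_le n u k : 0 <= u -> (grid_index n u <= k)%N = (u <= grid n k).
Proof.
move=> u0; rewrite /grid ler_pdivlMr// -lez_nat gez0_abs.
  by rewrite ceil_le_int.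
by rewrite ceil_ge0 (lt_le_trans (ltrN10 R))// mulr_ge0.
Qed.

Lemma le_grid_index n u : 0 <= u -> u <= grid n (grid_index n u).
Proof. by move=> u0; rewrite -grid_index_le. Qed.

Lemma grid_index_lt n u : 0 <= u -> grid n (grid_index n u) < u + n.+1%:R^-1.
Proof.
move=> u0; case E : (grid_index n u) => [|k].
  by rewrite /grid mul0r ltr_wpDl// invr_gt0.
have : ~~ (u <= grid n k) by rewrite -grid_index_le// E ltnn.
by rewrite -ltNge /grid -[k.+1%:R]natr1 mulrDl mul1r ltrD2r.
Qed.

Lemma cvg_grid_index u : 0 <= u -> grid n (grid_index n u) @[n --> \oo] --> u.
Proof.
move=> u0; apply: (@squeeze_cvgr _ _ _ _ (cst u) (fun n => u + harmonic n)).
- by apply: nearW => n; rewrite le_grid_index//= ltW// grid_index_lt.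
- exact: cvg_cst.
- rewrite -[X in _ --> X]addr0; apply: cvgD; [exact: cvg_cst|exact: cvg_harmonic].
Qed.

End grid.

Section continuous_process.
Context {d : measure_display} {T : measurableType d} {R : realType}.
Variable X : R -> T -> R.
Hypothesis cX : continuous_process X.

Lemma continuous_process_cvg w (u : R^nat) (l : R) : (forall n, 0 <= u n) -> 0 <= l ->
  u n @[n --> \oo] --> l -> X (u n) w @[n --> \oo] --> X l w.
Proof.
move=> u0 l0 ul.
apply: (@cvg_comp _ _ _ u (X ^~ w) \oo (within `[0, +oo[ (nbhs l))); last first.
  have cXw : {within `[0, +oo[, continuous (X ^~ w)} by exact: cX.
  by move/subspace_continuousP : cXw; apply; rewrite /= in_itv/= andbT.
move=> B hB; have : \forall n \near \oo, `[0, +oo[%classic (u n) -> B (u n) := ul _ hB.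
by apply: filterS => n; apply; rewrite /= in_itv/= andbT.
Qed.

Lemma continuous_process_grid w (u : R) : 0 <= u ->
  X (grid n (grid_index n u)) w @[n --> \oo] --> X u w.
Proof.
move=> u0; apply: continuous_process_cvg => // [n|]; first exact: grid_ge0.
exact: cvg_grid_index.
Qed.

End continuous_process.

Section martingale_convergence.
Context {d : measure_display} {T : measurableType d} {R : realType}.
Variables (P : probability T R) (F : R -> set (set T)).
Hypothesis filF : filtration F.
Variable M : R -> T -> R.
Hypothesis martM : martingale P F M.

Let mM t : 0 <= t -> measurable_fun setT (M t).
Proof.
by have [aM _ _] := martM => t0; exact: (measurable_wrt_fun filF t0 (aM _ t0)).
Qed.

Let intM t A : 0 <= t -> measurable A -> P.-integrable A (EFin \o M t).
Proof.
have [_ iM _] := martM => t0 mA.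
by apply: (@integrableS _ _ _ _ setT) => //; exact: iM.
Qed.

Let mD s t A : 0 <= s -> 0 <= t -> measurable_fun A (fun w => `|M t w - M s w|%:E).
Proof.
move=> s0 t0; apply: measurable_funTS; apply/measurable_EFinP.
by apply: measurableT_comp => //; apply: measurable_funB; exact: mM.
Qed.

Let integral_increment s u v A : 0 <= s -> s <= u -> u <= v -> F u A ->
  (\int[P]_(w in A) (M u w - M s w)%:E = \int[P]_(w in A) (M v w - M s w)%:E)%E.
Proof.
move=> s0 su uv FA; have u0 := le_trans s0 su; have v0 := le_trans u0 uv.
have mA : measurable A := filtration_measurable filF u0 FA.
under eq_integral do rewrite EFinB; rewrite integralB_EFin//; [|exact: intM..].
under [RHS]eq_integral do rewrite EFinB; rewrite [RHS]integralB_EFin//; [|exact: intM..].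
by rewrite (martingale_integral martM u0 uv FA).
Qed.

(** The submartingale property of |M - M_s|. The sign of M_u - M_s is known at time u; on each of
    the two events it cuts out, the absolute value at u is linear and the martingale property
    applies. *)
Let integral_increment_le s u v A : 0 <= s -> s <= u -> u <= v -> F u A ->
  (\int[P]_(w in A) `|M u w - M s w|%:E <= \int[P]_(w in A) `|M v w - M s w|%:E)%E.
Proof.
move=> s0 su uv FA; have u0 := le_trans s0 su; have v0 := le_trans u0 uv.
have sF := filtration_sigma filF u0; have mF := filtration_measurable filF u0.
have [aM _ _] := martM.
have FS : F u [set w | M s w <= M u w].
  by apply: measurable_wrt_le sF _ _ _ _; [exact: (measurable_wrt_mon filF s0 su (aM _ s0))|exact: aM].
pose A1 := A `&` [set w | M s w <= M u w].
pose A2 := A `\` [set w | M s w <= M u w].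
have FA1 : F u A1 by exact: sigma_setI.
have FA2 : F u A2 by exact: sigma_setD.
have A12 : A = A1 `|` A2 by rewrite setUIDK.
have dA : [disjoint A1 & A2] by apply/disj_setPS => w [[_ ?] [_]].
have mA1 := mF _ FA1; have mA2 := mF _ FA2.
rewrite A12 !ge0_integral_setU//; [|exact: mD..].
have le_part B g : measurable B -> P.-integrable B (EFin \o g) ->
    (\int[P]_(w in B) (g w)%:E <= \int[P]_(w in B) `|g w|%:E)%E.
  move=> mB iB; apply: le_integral => //; first exact: integrable_norm.
  by move=> w _; rewrite lee_fin ler_norm.
have iB a b B : 0 <= a -> 0 <= b -> measurable B ->
    P.-integrable B (EFin \o (fun w => M a w - M b w)).
  by move=> a0 b0 mB; exact: (integrableB mB (intM a0 mB) (intM b0 mB)).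
apply: leeD.
  rewrite (eq_integral (fun w => (M u w - M s w)%:E)); last first.
    by move=> w /set_mem[_ /= sw]; rewrite ger0_norm ?subr_ge0.
  rewrite (integral_increment s0 su uv FA1); apply: le_part => //.
  exact: iB.
rewrite (eq_integral (fun w => - (M u w - M s w)%:E)%E); last first.
  by move=> w /set_mem[_ /= /negP]; rewrite -ltNge => sw; rewrite ltr0_norm ?subr_lt0.
rewrite integralN/=; last by rewrite integrable_add_def//; exact: iB.
rewrite (integral_increment s0 su uv FA2) -integralN/=; last first.
  by rewrite integrable_add_def//; exact: iB.
rewrite (eq_integral (fun w => (M s w - M v w)%:E)); last first.
  by move=> w _; rewrite -[in RHS]opprB.
rewrite [leRHS](eq_integral (fun w => `|M s w - M v w|%:E)); last first.
  by move=> w _; rewrite distrC.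
by apply: le_part => //; exact: iB.
Qed.

Let exceed (s h lam : R) (n : nat) := [set w | exists2 i, (i <= n)%N &
  lam < `|M (s + h * i%:R) w - M s w|].

Let exceedS s h lam n : exceed s h lam n.+1 =
  exceed s h lam n `|` [set w | lam < `|M (s + h * n.+1%:R) w - M s w|].
Proof.
apply/seteqP; split => w /=.
  move=> [i]; rewrite leq_eqVlt ltnS => /orP[/eqP ->|ni] Di; first by right.
  by left; exists i.
by move=> [[i ni] Di|Di]; [exists i => //; exact: leqW|exists n.+1].
Qed.

Let time_le (s h : R) (i j : nat) : 0 <= h -> (i <= j)%N -> s + h * i%:R <= s + h * j%:R.
Proof. by move=> h0 ij; rewrite lerD2l ler_wpM2l// ler_nat. Qed.

Let exceed_adapted s h lam n : 0 <= s -> 0 <= h ->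
  F (s + h * n%:R) (exceed s h lam n).
Proof.
move=> s0 h0.
have t0 k : 0 <= s + h * k%:R by rewrite addr_ge0 ?mulr_ge0.
have one k : F (s + h * k%:R) [set w | lam < `|M (s + h * k%:R) w - M s w|].
  have sF := filtration_sigma filF (t0 k); have [aM _ _] := martM.
  apply: (measurable_wrt_lt sF); first exact: measurable_wrt_cst.
  apply/(measurable_wrtP sF)/measurableT_comp => //; apply: measurable_funB.
    exact/(measurable_wrtP sF)/aM.
  apply/(measurable_wrtP sF)/(measurable_wrt_mon filF s0 _ (aM _ s0)).
  by rewrite lerDl mulr_ge0.
elim: n => [|n ih].
  rewrite (_ : exceed _ _ _ _ = [set w | lam < `|M (s + h * 0%:R) w - M s w|])//.
  by apply/seteqP; split => w /=; [move=> [i]; rewrite leqn0 => /eqP ->|exists 0%N].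
rewrite exceedS; apply: sigma_setU => //; first exact: filtration_sigma.
by apply: filtration_le ih => //; exact: time_le.
Qed.

(* Doob's maximal inequality, by splitting off the event first reached at n.+1. *)
Let maximal s h lam n : 0 <= s -> 0 <= h -> 0 <= lam ->
  (lam%:E * P (exceed s h lam n) <=
   \int[P]_(w in exceed s h lam n) `|M (s + h * n%:R) w - M s w|%:E)%E.
Proof.
move=> s0 h0 lam0.
have t0 k : 0 <= s + h * k%:R by rewrite addr_ge0 ?mulr_ge0.
have sF k := filtration_sigma filF (t0 k); have mF k := filtration_measurable filF (t0 k).
have mE k := mF _ _ (exceed_adapted lam k s0 h0).
have Markov k B : measurable B ->
    (forall w, B w -> lam < `|M (s + h * k%:R) w - M s w|) ->
    (lam%:E * P B <= \int[P]_(w in B) `|M (s + h * k%:R) w - M s w|%:E)%E.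
  move=> mB BD; rewrite -integral_cst//; apply: le_integral_ge0 => w Bw.
    by rewrite lee_fin.
  by rewrite lee_fin ltW// BD.
elim: n => [|n ih].
  by apply: Markov => // w /= [i]; rewrite leqn0 => /eqP ->.
pose B := exceed s h lam n.+1 `\` exceed s h lam n.
have sub : exceed s h lam n `<=` exceed s h lam n.+1.
  by rewrite exceedS; exact: subsetUl.
have EB : exceed s h lam n.+1 = exceed s h lam n `|` B by rewrite setDUK.
have mB : measurable B by exact: measurableD.
have dB : [disjoint exceed s h lam n & B] by apply/disj_setPS => w [? [_]].
rewrite EB measureU//; last exact/disj_set2P.
rewrite ge0_muleDr// ge0_integral_setU//; last exact: mD.
apply: leeD.
  apply: le_trans ih _; apply: integral_increment_le => //.
  - by rewrite lerDl mulr_ge0.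
  - exact: time_le.
  - exact: exceed_adapted.
by apply: Markov => // w [+ Ew]; rewrite exceedS => -[].
Qed.

Hypothesis cM : continuous_process M.

(** [E n] looks at the times s + i / (n + 1) over a horizon n. These grids are not nested, hence the
    union over m of the events where all [E n] with n >= m occur: it has probability at most e
    because each intersection lies in [E m]. It contains every exceedance, because a strict
    inequality at time u persists, by continuity, at the rounded times. *)
Let sup_exceed s lam e : 0 <= s -> 0 < lam ->
  (forall t, s <= t -> (\int[P]_w `|M t w - M s w|%:E <= (lam * e)%:E)%E) ->
  exists N, [/\ measurable N, (P N <= e%:E)%E &
    forall w, (exists2 u, s <= u & lam < `|M u w - M s w|) -> N w].
Proof.
move=> s0 lam0 L1.
pose h n : R := n.+1%:R^-1; pose E n := exceed s (h n) lam (n * n.+1)%N.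
have h0 n : 0 <= h n by rewrite invr_ge0.
have t0 n k : 0 <= s + h n * k%:R by rewrite addr_ge0 ?mulr_ge0.
have mE n : measurable (E n).
  exact: (filtration_measurable filF (t0 _ _) (exceed_adapted _ _ s0 (h0 n))).
have PE n : (P (E n) <= e%:E)%E.
  have : (lam%:E * P (E n) <= lam%:E * e%:E)%E.
    apply: le_trans (maximal _ s0 (h0 n) (ltW lam0)) _.
    apply: (le_trans _ (L1 (s + h n * (n * n.+1)%N%:R) _)); last by rewrite lerDl mulr_ge0.
    by apply: ge0_subset_integral => //; [exact: mE|exact: (mD s0 (t0 _ _))].
  by rewrite lee_pmul2l// lte_fin.
pose G m := \bigcap_(n >= m) E n.
have mG m : measurable (G m) by apply: bigcap_measurable => //; exists m => /=.
have mN : measurable (\bigcup_m G m) by exact: bigcupT_measurable.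
exists (\bigcup_m G m); split => //.
  have /cvg_lim <- // : P (G m) @[m --> \oo] --> P (\bigcup_m G m).
    apply: nondecreasing_cvg_mu => // m p mp; apply/subsetPset => w Gw n /= pn.
    exact/Gw/(leq_trans mp).
  apply: lime_le.
    apply/cvg_ex; eexists; apply: nondecreasing_cvg_mu => // m p mp.
    by apply/subsetPset => w Gw n /= pn; exact/Gw/(leq_trans mp).
  apply: nearW => m; apply: le_trans (PE m); apply: le_measure; rewrite ?inE//.
  by move=> w; apply => /=.
move=> w [u su lamu].
pose v n := s + grid n (grid_index n (u - s)).
have us0 : 0 <= u - s by rewrite subr_ge0.
have vu : v n @[n --> \oo] --> u.
  rewrite [X in _ --> X](_ : u = s + (u - s)); last by rewrite addrC subrK.
  by apply: cvgD; [exact: cvg_cst|exact: cvg_grid_index].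
have /cvg_norm : M (v n) w - M s w @[n --> \oo] --> M u w - M s w.
  apply: cvgB; last exact: cvg_cst.
  apply: (continuous_process_cvg cM) => //; last exact: le_trans su.
  by move=> n; rewrite addr_ge0// grid_ge0.
move=> /cvgr_gt/(_ _ lamu) [m _ hm].
have [p hp] : exists p : nat, u - s <= p%:R.
  by exists (Num.bound (u - s)); rewrite ltW// archi_boundP.
exists (maxn m p) => // n /=; rewrite geq_max => /andP[mn pn].
exists (grid_index n (u - s)).
  by rewrite grid_index_le// /grid natrM mulfK// (le_trans hp)// ler_nat.
by have := hm n mn; rewrite /v /grid mulrC.
Qed.

Hypothesis M_ge0 : forall t w, 0 <= t -> 0 <= M t w.
Hypothesis sE : small_excess P [set M t | t in `[0, +oo[].

Lemma martingale_cvg : {ae P, forall w, cvg (M t w @[t --> +oo])}.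
Proof.
(* A path without a finite limit fails Cauchy's criterion and so lies in [osc (1 / (k + 1))] for
   some k. Each of these sets is null: an L1 bound lam / (k + 1) on the increments covers [osc lam]
   by an event of probability at most 1 / (k + 1). *)
pose osc lam := [set w | forall s, 0 <= s ->
  exists2 u, s <= u & lam < `|M u w - M s w|].
have osc0 lam : 0 < lam -> P.-negligible (osc lam).
  move=> lam0.
  have /choice[N hN] : forall k : nat, exists N, [/\ measurable N,
      (P N <= (k.+1%:R^-1)%:E)%E & osc lam `<=` N].
    move=> k; have e0 : 0 < lam * k.+1%:R^-1 by rewrite mulr_gt0.
    have [s s0 hs] := martingale_cauchy_L1 filF martM M_ge0 sE e0.
    have [N [mN PN subN]] := sup_exceed s0 lam0 hs.
    by exists N; split => // w osw; apply: subN; exact: osw.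
  exists (\bigcap_k N k); split; last by move=> w ow k _; have [_ _] := hN k; exact.
    by apply: bigcap_measurable => [|k _]; [exists 0%N|have [] := hN k].
  apply/eqP; rewrite eq_le measure_ge0 andbT; apply/lee_addgt0Pr => e e0; rewrite add0e.
  have [k _ /(_ k (leqnn k)) /= ke] := near_infty_natSinv_lt (PosNum e0).
  have [mN PN _] := hN k.
  apply: (@le_trans _ _ (P (N k))).
    apply: le_measure; rewrite ?inE//; last by move=> w; exact.
    by apply: bigcap_measurable => [|j _]; [exists 0%N|have [] := hN j].
  by rewrite (le_trans PN)// lee_fin ltW.
have : P.-negligible (\bigcup_k osc k.+1%:R^-1).
  by apply: negligible_bigcup => k; apply: osc0; rewrite invr_gt0.
apply: negligibleS => w /=; apply: contra_notP => nosc.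
apply/cauchy_cvgP/cauchy_exP => e e0.
have [k _ /(_ k (leqnn k)) /= ke] := near_infty_natSinv_lt (PosNum e0).
have : ~ osc k.+1%:R^-1 w by move=> ow; apply: nosc; exists k.
move=> /existsNP[s /not_implyP[s0 hs]]; exists (M s w).
exists s; split; first by rewrite num_real.
move=> u su /=; rewrite /ball /= distrC (le_lt_trans _ ke)// leNgt.
by apply/negP => lamu; apply: hs; exists u => //; exact: ltW.
Qed.

End martingale_convergence.

(** * Terminal values *)

Section terminal.
Context {d : measure_display} {T : measurableType d} {R : realType}.

Lemma cvg_natr_pinfty : (n%:R : R) @[n --> \oo] --> +oo.
Proof. exact: cvgr_idn. Qed.

Lemma terminal_cvgn (X : R -> T -> R) w l :
  (X t w)%:E @[t --> +oo] --> l ->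
  terminal X w = l /\ (X n%:R w)%:E @[n --> \oo] --> l.
Proof.
move=> Xl; split; first by apply/cvg_lim.
exact: (cvg_comp _ _ cvg_natr_pinfty Xl).
Qed.

Lemma terminal_nondecreasing (X : R -> T -> R) w : nondecreasing_process X ->
  (X n%:R w)%:E @[n --> \oo] --> terminal X w /\
  forall t, 0 <= t -> ((X t w)%:E <= terminal X w)%E.
Proof.
(* Negative times are unconstrained; freezing the process there at X_0 gives a function monotone on
   the whole line. *)
move=> ndX; pose f t := (X (Num.max t 0) w)%:E.
have ndf : {homo f : s t / s <= t >-> (s <= t)%E}.
  move=> s t st; rewrite lee_fin; apply: ndX; first by rewrite le_max lexx orbT.
  by apply: le_max2.
have fl := nondecreasing_cvge ndf.
have Xl : (X t w)%:E @[t --> +oo] --> ereal_sup (range f).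
  apply: cvg_trans fl; apply: near_eq_cvg.
  by near=> t; rewrite /f max_l//; near: t; exact: nbhs_pinfty_ge.
have [-> Xn] := terminal_cvgn Xl; split => // t t0.
by apply: ereal_sup_ubound; exists t => //; rewrite /f max_l.
Unshelve. all: by end_near. Qed.

End terminal.

Section ui_martingale.
Context {d : measure_display} {T : measurableType d} {R : realType}.
Variables (P : probability T R) (F : R -> set (set T)).
Hypothesis filF : filtration F.
Variables M C : R -> T -> R.
Hypothesis cM : continuous_process M.
Hypothesis martM : martingale P F M.
Hypothesis M_ge0 : forall t w, 0 <= t -> 0 <= M t w.
Hypothesis sE : small_excess P [set M t | t in `[0, +oo[].
Hypothesis C_adapted : adapted F C.
Hypothesis C_nd : nondecreasing_process C.
Hypothesis C0 : forall w, C 0 w = 1.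

(** A substitute for [terminal] that is meaningful at every point: for M it is nonnegative and
    measurable, being a lower limit along the integers, and it agrees with [terminal M] almost
    surely. *)
Definition terminal_inf (X : R -> T -> R) w := limn_einf (fun n => (X n%:R w)%:E).

Let mM t : 0 <= t -> measurable_fun setT (M t).
Proof.
by have [aM _ _] := martM => t0; exact: (measurable_wrt_fun filF t0 (aM _ t0)).
Qed.

Let mC t : 0 <= t -> measurable_fun setT (C t).
Proof. by move=> t0; exact: (measurable_wrt_fun filF t0 (C_adapted t0)). Qed.

Let C_ge1 t w : 0 <= t -> 1 <= C t w.
Proof. by move=> t0; rewrite -(C0 w); exact: C_nd. Qed.

Let C_ge0 t w : 0 <= t -> 0 <= C t w.
Proof. by move=> t0; rewrite (le_trans _ (C_ge1 w t0)). Qed.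

Lemma terminal_inf_ge0 w : (0 <= terminal_inf M w)%E.
Proof.
rewrite /terminal_inf limn_einf_lim; apply: lime_ge; first exact: is_cvg_einfs.
by apply: nearW => n; apply: le_ereal_inf_tmp => _ [m /= _ <-]; rewrite lee_fin M_ge0.
Qed.

Lemma measurable_terminal_inf : measurable_fun setT (terminal_inf M).
Proof.
rewrite /terminal_inf /limn_einf; apply: measurableT_comp => //.
apply: (@measurable_fun_limn_esup _ _ _ _ (fun n w => - (M n%:R w)%:E)%E) => n.
by apply: measurableT_comp => //; apply/measurable_EFinP; exact: mM.
Qed.

Lemma terminal_infE : {ae P, forall w, terminal M w = terminal_inf M w}.
Proof.
apply: filterS (martingale_cvg filF martM cM M_ge0 sE) => w /cvg_ex[l Ml].
have [-> Mn] : terminal M w = l%:E /\ (M n%:R w)%:E @[n --> \oo] --> l%:E.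
  by apply: terminal_cvgn; apply: cvg_EFin; [exact: nearW|].
by rewrite /terminal_inf (cvg_limn_einf_sup Mn).1.
Qed.

Lemma cvg_terminal_inf :
  {ae P, forall w, (M n%:R w)%:E @[n --> \oo] --> terminal_inf M w}.
Proof.
apply: filterS (martingale_cvg filF martM cM M_ge0 sE) => w /cvg_ex[l Ml].
have [_ Mn] : terminal M w = l%:E /\ (M n%:R w)%:E @[n --> \oo] --> l%:E.
  by apply: terminal_cvgn; apply: cvg_EFin; [exact: nearW|].
by rewrite /terminal_inf (cvg_limn_einf_sup Mn).1.
Qed.

(** M is closed by its terminal value: on an event of F_s the integrals of M_n do not depend on n >=
    s, and Vitali's theorem identifies their limit. *)
Lemma integral_terminal_inf s A : 0 <= s -> F s A ->
  (\int[P]_(w in A) (M s w)%:E = \int[P]_(w in A) terminal_inf M w)%E.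
Proof.
move=> s0 FA; have mA := filtration_measurable filF s0 FA.
have : (\int[P]_(w in A) (M n%:R w)%:E @[n --> \oo] -->
        \int[P]_(w in A) terminal_inf M w)%E.
  apply: (@vitali _ _ _ _ (fun n => M n%:R)) => //.
  - by move=> n; exact: mM.
  - by move=> n w; exact: M_ge0.
  - exact: measurable_terminal_inf.
  - exact: terminal_inf_ge0.
  - exact: cvg_terminal_inf.
  - move=> e e0; have [K K0 hK] := sE e0; exists K => // _ [n _ <-].
    by apply: hK; exists n%:R => //=; rewrite in_itv/= andbT.
apply: cvg_unique => //; apply: cvg_near_cst.
near=> n; rewrite -(martingale_integral martM s0 _ FA)//.
by near: n; exact: nbhs_infty_ger. 
Unshelve. all: by end_near. Qed.

Lemma integral_mul_terminal_inf s (H : T -> R) : 0 <= s ->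
  measurable_wrt (F s) H -> (forall w, 0 <= H w) ->
  (\int[P]_w ((H w)%:E * (M s w)%:E) <= \int[P]_w ((H w)%:E * terminal_inf M w))%E.
Proof.
move=> s0 mH H0.
apply: le_integral_mul (filtration_sigma filF s0) _ _ _ _ _ _ mH H0.
- exact: filtration_measurable.
- by apply/measurable_EFinP; exact: mM.
- by move=> w; rewrite lee_fin M_ge0.
- exact: measurable_terminal_inf.
- exact: terminal_inf_ge0.
- by move=> A FA; rewrite (integral_terminal_inf s0 FA).
Qed.

Let mC_inf : measurable_fun setT (terminal C).
Proof.
apply: (@emeasurable_fun_cvg _ _ _ _ (fun n w => (C n%:R w)%:E)).
  by move=> n; apply/measurable_EFinP; exact: mC.
by move=> w _; have [] := terminal_nondecreasing w C_nd.
Qed.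

Lemma measurable_terminal_prod :
  measurable_fun setT (fun w => terminal_inf M w * terminal C w)%E.
Proof. exact: emeasurable_funM measurable_terminal_inf mC_inf. Qed.

Let C_inf_ge1 w : (1 <= terminal C w)%E.
Proof.
have [_ /(_ 0 (lexx _))] := terminal_nondecreasing w C_nd.
by rewrite C0.
Qed.

Lemma terminal_prod_ge0 w : (0 <= terminal_inf M w * terminal C w)%E.
Proof. by rewrite mule_ge0 ?terminal_inf_ge0// (le_trans _ (C_inf_ge1 w)). Qed.

(** Fatou is applied twice, first in n with C frozen at time k, then in k with M_oo fixed. Thus M_n
    -> 0 and C_n -> oo never have to be handled together. *)
Lemma le_integral_terminal (B : \bar R) :
  (forall n, \int[P]_w (M n%:R w * C n%:R w)%:E <= B)%E ->
  (\int[P]_w (terminal_inf M w * terminal C w) <= B)%E.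
Proof.
move=> hB.
have step k : (\int[P]_w (terminal_inf M w * (C k%:R w)%:E) <= B)%E.
  apply: (@fatou_le _ _ _ _ _ (fun n w => (M n%:R w)%:E * (C k%:R w)%:E)%E) => //.
  - move=> n; apply: emeasurable_funM; apply/measurable_EFinP; [exact: mM|exact: mC].
  - by move=> n w _; rewrite -EFinM lee_fin mulr_ge0 ?M_ge0 ?C_ge0.
  - apply: emeasurable_funM; first exact: measurable_terminal_inf.
    by apply/measurable_EFinP; exact: mC.
  - by move=> w _; rewrite mule_ge0 ?terminal_inf_ge0// lee_fin C_ge0.
  - apply: filterS cvg_terminal_inf => w Mw _.
    have /cvg_limn_einf_sup[-> _]// : ((M n%:R w)%:E * (C k%:R w)%:E)%E @[n --> \oo] -->
        (terminal_inf M w * (C k%:R w)%:E)%E by exact: cvgeZr.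
  - exists k => // n /= kn; apply: le_trans (hB n); apply: le_integral_ge0 => w _.
      by rewrite -EFinM lee_fin mulr_ge0 ?M_ge0 ?C_ge0.
    by rewrite -EFinM lee_fin ler_wpM2l ?M_ge0// C_nd// ler_nat.
apply: (@fatou_le _ _ _ _ _ (fun k w => terminal_inf M w * (C k%:R w)%:E)%E) => //.
- move=> k; apply: emeasurable_funM; first exact: measurable_terminal_inf.
  by apply/measurable_EFinP; exact: mC.
- by move=> k w _; rewrite mule_ge0 ?terminal_inf_ge0// lee_fin C_ge0.
- exact: measurable_terminal_prod.
- by move=> w _; exact: terminal_prod_ge0.
- apply: aeW => w _; have [Cw _] := terminal_nondecreasing w C_nd.
  have [Mw0|Mw0] := eqVneq (terminal_inf M w) 0%E.
    rewrite Mw0 mul0e (_ : (fun k => _) = cst 0%E); last first.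
      by apply/funext => k; rewrite mul0e.
    by rewrite (cvg_limn_einf_sup (cvg_cst _)).1.
  have /cvg_limn_einf_sup[-> _]// : (terminal_inf M w * (C k%:R w)%:E)%E @[k --> \oo] -->
     (terminal_inf M w * terminal C w)%E.
  apply: cvgeM Cw; last exact: cvg_cst.
  (* The case M_oo = 0 is settled and C_oo >= 1, so no indeterminate product remains. *)
  have [Cf|Cf] := boolP (terminal C w \is a fin_num); last exact: mule_def_neq0_infty.
  have [Mf|Mf] := boolP (terminal_inf M w \is a fin_num); first exact: mule_def_fin.
  by apply: mule_def_infty_neq0; rewrite // gt_eqF// (lt_le_trans _ (C_inf_ge1 w)).
- by apply: nearW.
Qed.

Lemma integral_le_terminal n :
  (\int[P]_w (M n%:R w * C n%:R w)%:E <= \int[P]_w (terminal_inf M w * terminal C w))%E.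
Proof.
have n0 : 0 <= n%:R :> R by [].
under eq_integral do rewrite mulrC EFinM.
apply: le_trans (integral_mul_terminal_inf n0 (C_adapted n0) _) _.
  by move=> w; exact: C_ge0.
apply: le_integral_ge0 => w _.
  by rewrite mule_ge0 ?terminal_inf_ge0// lee_fin C_ge0.
rewrite muleC lee_wpmul2l ?terminal_inf_ge0//.
by have [_ /(_ _ n0)] := terminal_nondecreasing w C_nd.
Qed.

End ui_martingale.

(** * Class (D) *)

Section excess_tail.
Context {d : measure_display} {T : measurableType d} {R : realType}.
Variable P : probability T R.

Lemma excess_tail (Z : T -> \bar R) (e : R) :
  measurable_fun setT Z -> (forall w, 0 <= Z w)%E ->
  (\int[P]_w Z w < +oo)%E -> 0 < e ->
  exists2 K : R, 0 <= K & (\int[P]_w excess K (Z w) <= e%:E)%E.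
Proof.
move=> mZ Z0 Zoo e0.
have iZ : P.-integrable setT Z.
  apply/integrableP; split => //.
  by under eq_integral do rewrite gee0_abs//.
have le_exc K w : 0 <= K -> (excess K (Z w) <= Z w)%E.
  move=> K0; rewrite /excess ge_max Z0 andbT leeBlDr// leeDl// lee_fin.
have [||||_ _] := @dominated_convergence _ _ _ P setT measurableT
    (fun n w => excess n%:R (Z w)) (cst 0%E) Z _ (measurable_cst _).
- by move=> n; exact: measurable_excess.
- apply: filterS (integrable_ae measurableT iZ) => w /(_ Logic.I) Zw _.
  apply: cvg_near_cst; near=> n.
  rewrite -(fineK Zw) excessEFin max_r// subr_le0.
  by near: n; exact: nbhs_infty_ger.
- exact: iZ.
- by apply: aeW => w n _; rewrite gee0_abs ?excess_ge0// le_exc.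
rewrite integral0 => /fine_cvgP[fin /cvgrPdist_le/(_ _ e0) he].
near \oo => n; exists n%:R => //.
have In : (\int[P]_w excess n%:R (Z w))%E \is a fin_num by near: n.
have : `|0 - fine (\int[P]_w excess n%:R (Z w))%E| <= e by near: n.
by rewrite sub0r normrN -(fineK In) lee_fin; exact/le_trans/ler_norm.
Unshelve. all: by end_near. Qed.

End excess_tail.

Section class_D.
Context {d : measure_display} {T : measurableType d} {R : realType}.
Variables (P : probability T R) (F : R -> set (set T)).
Hypothesis filF : filtration F.
Variables M C : R -> T -> R.
Hypothesis cM : continuous_process M.
Hypothesis cC : continuous_process C.
Hypothesis martM : martingale P F M.
Hypothesis M_ge0 : forall t w, 0 <= t -> 0 <= M t w.
Hypothesis sE : small_excess P [set M t | t in `[0, +oo[].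
Hypothesis C_adapted : adapted F C.
Hypothesis C_nd : nondecreasing_process C.
Hypothesis C0 : forall w, C 0 w = 1.

Let X t w := M t w * C t w.
Let Z w : \bar R := (terminal_inf M w * terminal C w)%E.

Let C_ge0 t w : 0 <= t -> 0 <= C t w.
Proof. by move=> t0; rewrite (@le_trans _ _ 1)// -(C0 w); exact: C_nd. Qed.

Let X_ge0 t w : 0 <= t -> 0 <= X t w.
Proof. by move=> t0; rewrite mulr_ge0 ?M_ge0 ?C_ge0. Qed.

Let X_wrt t : 0 <= t -> measurable_wrt (F t) (X t).
Proof.
have [aM _ _] := martM => t0; have sF := filtration_sigma filF t0.
apply/(measurable_wrtP sF)/measurable_funM; apply/(measurable_wrtP sF).
  exact: aM.
exact: C_adapted.
Qed.

Let mX t : 0 <= t -> measurable_fun setT (fun w => (X t w)%:E).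
Proof. by move=> t0; apply/measurable_EFinP; exact: (measurable_wrt_fun filF t0 (X_wrt t0)). Qed.

Let mZ : measurable_fun setT Z.
Proof. exact: (measurable_terminal_prod filF martM C_adapted C_nd). Qed.

Let Z_ge0 w : (0 <= Z w)%E.
Proof. exact: terminal_prod_ge0. Qed.

(* Conditional Jensen inequality for the convex function x |-> max (x - K, 0). *)
Let integral_excess t A (K : R) : 0 <= t -> 0 <= K -> F t A ->
  (\int[P]_(w in A) excess K (X t w)%:E <= \int[P]_(w in A) excess K (Z w))%E.
Proof.
move=> t0 K0 FA; have sF := filtration_sigma filF t0.
have mF := filtration_measurable filF t0.
(* The excess of X_t is X_t - K on [G] and vanishes on the rest of [A]. As [G] and C_t are known at
   time t, E[X_t; G] <= E[Z; G]; the bound Z <= K + (Z - K)^+ then finishes, with K P(G) added to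
   both sides rather than subtracted. *)
pose G := A `&` [set w | K < X t w].
have FG : F t G.
  apply: sigma_setI => //; apply: measurable_wrt_lt => //; last exact: X_wrt.
  exact: measurable_wrt_cst.
have mA := mF _ FA; have mG := mF _ FG.
have GA : G `<=` A by exact: subIsetl.
have mK D (W : T -> \bar R) : measurable_fun setT W ->
    measurable_fun D (fun w => excess K (W w)).
  by move=> mW; apply: measurable_funTS; exact: measurable_excess.
have -> : (\int[P]_(w in A) excess K (X t w)%:E = \int[P]_(w in G) excess K (X t w)%:E)%E.
  rewrite integral_mkcond [RHS]integral_mkcond; apply: eq_integral => w _.
  rewrite /patch; case: (boolP (w \in G)) => [/set_mem Gw|nG].
    by rewrite mem_set//; exact: GA.
  case: ifPn => // /set_mem Aw; rewrite excessEFin max_r// subr_le0 leNgt.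
  by apply/negP => KX; move/negP : nG; apply; exact/mem_set.
have PGfin : (K%:E * P G)%E \is a fin_num.
  by rewrite fin_numM// ge0_fin_numE// (le_lt_trans (probability_le1 P mG))// ltry.
rewrite -(leeD2rE _ _ PGfin).
have -> : (\int[P]_(w in G) excess K (X t w)%:E + K%:E * P G =
           \int[P]_(w in G) (X t w)%:E)%E.
  rewrite -integral_cst// -ge0_integralD//.
  - apply: eq_integral => w /set_mem[_ /= KX].
    by rewrite excessEFin max_l ?subr_ge0 ?ltW// -EFinD subrK.
  - by move=> w _; exact: excess_ge0.
  - by apply: mK; exact: mX.
apply: (@le_trans _ _ (\int[P]_(w in G) Z w)%E).
  have -> : (\int[P]_(w in G) (X t w)%:E =
             \int[P]_w ((\1_G w * C t w)%:E * (M t w)%:E))%E.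
    rewrite -integral_mul_indic//; apply: eq_integral => w _.
    by rewrite -!EFinM /X; congr EFin; ring.
  apply: (le_trans (integral_mul_terminal_inf filF cM martM M_ge0 sE t0 _ _)).
  - apply/(measurable_wrtP sF)/measurable_funM.
      by apply: measurable_indic; rewrite g_sigma_measurableE.
    by apply/(measurable_wrtP sF); exact: C_adapted.
  - by move=> w; rewrite mulr_ge0 ?C_ge0// indicE.
  rewrite -(integral_mul_indic P Z mG); apply: le_integral_ge0 => w _.
    by rewrite mule_ge0 ?terminal_inf_ge0// lee_fin mulr_ge0 ?C_ge0// indicE.
  rewrite EFinM -muleA lee_wpmul2l ?lee_fin ?indicE//.
  rewrite muleC lee_wpmul2l ?terminal_inf_ge0//.
  by have [_ /(_ _ t0)] := terminal_nondecreasing w C_nd.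
apply: (@le_trans _ _ (\int[P]_(w in G) (excess K (Z w) + K%:E)))%E.
  by apply: le_integral_ge0 => // w _; rewrite addeC; exact: le_cst_excess.
rewrite ge0_integralD//; [|by move=> w _; exact: excess_ge0|exact: mK].
rewrite integral_cst//; apply: leeD2r; apply: ge0_subset_integral => //.
  exact: mK.
by move=> w _; exact: excess_ge0.
Qed.

Variable tau : T -> \bar R.
Hypothesis tau_stop : stopping_time F tau.
Hypothesis tau_fin : forall w, (tau w < +oo)%E.

Let tau_ge0 w : 0 <= fine (tau w).
Proof. by apply: fine_ge0; exact: tau_stop.1. Qed.

Let tauE w : (fine (tau w))%:E = tau w.
Proof. by rewrite fineK// ge0_fin_numE//; exact: tau_stop.1. Qed.

Let level n k := [set w | grid_index n (fine (tau w)) = k].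

Let F_level n k : F (grid n k) (level n k).
Proof.
have le_level j : F (grid n j) [set w | (grid_index n (fine (tau w)) <= j)%N].
  rewrite (_ : [set w | _] = [set w | (tau w <= (grid n j)%:E)%E]).
    exact: tau_stop.2 (grid_ge0 _ _).
  by apply/seteqP; split => w /=; rewrite grid_index_le// -lee_fin tauE.
case: k => [|k].
  rewrite (_ : level n 0 = [set w | (grid_index n (fine (tau w)) <= 0)%N])//.
  by apply/seteqP; split => w /=; rewrite leqn0 => /eqP.
rewrite (_ : level n k.+1 = [set w | (grid_index n (fine (tau w)) <= k.+1)%N] `\`
    [set w | (grid_index n (fine (tau w)) <= k)%N]).
  apply: sigma_setD => //; first exact/filtration_sigma/grid_ge0.
  by apply: (filtration_le filF (grid_ge0 _ _) _ (le_level k)); rewrite grid_mono.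
apply/seteqP; split => w /=; first by rewrite /level/= => ->; rewrite leqnn ltnn.
move=> [kS /negP]; rewrite -ltnNge => kI.
by apply/eqP; rewrite eqn_leq kS.
Qed.

Let m_level n k : measurable (level n k).
Proof. exact: (filtration_measurable filF (grid_ge0 _ _) (F_level n k)). Qed.

Let bigcup_level n : \bigcup_k level n k = setT.
Proof. by apply/seteqP; split => // w _; exists (grid_index n (fine (tau w))). Qed.

Let Xn n w := X (grid n (grid_index n (fine (tau w)))) w.

Let Xn_level n k w : level n k w -> Xn n w = X (grid n k) w.
Proof. by rewrite /level/= /Xn => ->. Qed.

Let mXn n : measurable_fun setT (fun w => (Xn n w)%:E).
Proof.
rewrite -(bigcup_level n); apply/measurable_fun_bigcup => // k.
apply: (eq_measurable_fun (fun w => (X (grid n k) w)%:E)).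
  by move=> w /set_mem /Xn_level ->.
by apply: measurable_funTS; apply: mX; exact: grid_ge0.
Qed.

(** On each of the countably many levels the rounded time is a constant, and the level is known at
    that time, so the inequality at deterministic times can be summed. *)
Let Xn_excess n K : 0 <= K ->
  (\int[P]_w excess K (Xn n w)%:E <= \int[P]_w excess K (Z w))%E.
Proof.
move=> K0; rewrite -(bigcup_level n).
have tl : trivIset setT (level n) by exact: trivIset_preimage1.
rewrite ge0_integral_bigcup//; last 2 first.
- by rewrite bigcup_level; exact: measurable_excess.
- by move=> w _; exact: excess_ge0.
rewrite ge0_integral_bigcup//; last 2 first.
- by rewrite bigcup_level; exact: measurable_excess.
- by move=> w _; exact: excess_ge0.
apply: lee_nneseries => k _; first by move=> _; apply: integral_ge0 => w _; exact: excess_ge0.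
rewrite (eq_integral (fun w => excess K (X (grid n k) w)%:E)); last first.
  by move=> w /set_mem /Xn_level ->.
by apply: integral_excess => //; exact: grid_ge0.
Qed.

Let cvg_Xn w : Xn n w @[n --> \oo] --> X (fine (tau w)) w.
Proof. by apply: cvgM; exact: continuous_process_grid. Qed.

Lemma measurable_stopped_prod :
  measurable_fun setT (fun w => M (fine (tau w)) w * C (fine (tau w)) w).
Proof.
apply: (@measurable_fun_cvg _ _ _ _ Xn); last by move=> w _; exact: cvg_Xn.
by move=> n; apply/measurable_EFinP; exact: mXn.
Qed.

Lemma integral_excess_stopped (K : R) : 0 <= K ->
  (\int[P]_w excess K (M (fine (tau w)) w * C (fine (tau w)) w)%:E <=
   \int[P]_w excess K (terminal_inf M w * terminal C w))%E.
Proof.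
move=> K0; apply: (@fatou_le _ _ _ _ _ (fun n w => excess K (Xn n w)%:E)) => //.
- by move=> n; exact: measurable_excess.
- by move=> n w _; exact: excess_ge0.
- by apply: measurable_excess; apply/measurable_EFinP; exact: measurable_stopped_prod.
- by move=> w _; exact: excess_ge0.
- apply: aeW => w _.
  have Xc : (Xn n w)%:E @[n --> \oo] --> (X (fine (tau w)) w)%:E.
    by apply: cvg_EFin; [exact: nearW|exact: cvg_Xn].
  by rewrite (cvg_limn_einf_sup (cvg_excess (K := K) _ Xc)).1// lee_fin X_ge0.
- by apply: nearW => n; exact: Xn_excess.
Qed.

End class_D.

(** * Riemann sums and pathwise Stieltjes integrals *)

Section riemann_sum.
Context {R : realType}.

(** The integrand is evaluated at the right endpoint, when the increment of c is already known;
    under the expectation a martingale may then be replaced there by its value at any later time. *)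
Definition riemann_sum (f c : R -> R) n N : R :=
  \sum_(i < N) f (grid n i.+1) * (c (grid n i.+1) - c (grid n i)).

Variables f c : R -> R.
Hypothesis c_nd : forall s t : R, 0 <= s -> s <= t -> c s <= c t.
Hypothesis cc : {within `[0, +oo[, continuous c}.
Hypothesis f_ge0 : forall t, 0 <= t -> 0 <= f t.
Hypothesis cf : {within `[0, +oo[, continuous f}.

Let mu : {measure set (measurableTypeR R) -> \bar R} :=
  lebesgue_stieltjes_measure (cumulative_path c).

Let extend0_ge0 t : 0 <= t -> extend0 c t = c t.
Proof. by move=> t0; rewrite /extend0 max_l. Qed.

Let mu_itv (a b : R) : a <= b ->
  mu `]a, b]%classic = (extend0 c b - extend0 c a)%:E.
Proof.
move=> ab; rewrite [LHS]/(lebesgue_stieltjes_measure _ _)/=.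
rewrite /lebesgue_stieltjes_measure/= /measure_extension/=.
rewrite measurable_mu_extE/=; last exact: is_ocitv.
by rewrite wlength_itv_bnd// cumulative_pathE.
Qed.

Lemma stieltjes_itv (a b : R) : 0 <= a -> a <= b -> mu `]a, b]%classic = (c b - c a)%:E.
Proof. by move=> a0 ab; rewrite mu_itv// !extend0_ge0// (le_trans a0). Qed.

(** The extension is constant on the left of 0, so []-1, 0]] already has no mass. Hence cells []a,
    b]] suffice for an integral over [[0, +oo[]. *)
Lemma stieltjes_set0 : mu [set 0] = 0%E.
Proof.
apply/eqP; rewrite eq_le measure_ge0 andbT.
have <- : mu `](-1)%R, 0%R]%classic = 0%E.
  by rewrite mu_itv ?oppr_le0// /extend0 maxxx max_r ?oppr_le0// subrr.
apply: le_measure; rewrite ?inE//.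
by move=> _ /= ->; rewrite in_itv/= lexx oppr_lt0 ltr01.
Qed.

(** The step function whose integral against dc is the Riemann sum; its left-open cells match the
    upward rounding of [grid_index]. *)
Definition grid_step n N (s : R) : R :=
  \sum_(i < N) f (grid n i.+1) * \1_(`]grid n i, grid n i.+1]) s.

Lemma grid_step_ge0 n N s : 0 <= grid_step n N s.
Proof.
by apply: sumr_ge0 => i _; rewrite mulr_ge0 ?f_ge0 ?grid_ge0// indicE.
Qed.

Lemma measurable_grid_step n N (D : set R) : measurable_fun D (grid_step n N).
Proof.
by apply: measurable_sum => i; apply: measurable_funM.
Qed.

Lemma grid_stepE n N s : 0 < s -> s <= grid n N ->
  grid_step n N s = f (grid n (grid_index n s)).
Proof.
move=> s0 sN.
have : (grid_index n s <= N)%N by rewrite (grid_index_le _ _ (ltW s0)).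
have : (0 < grid_index n s)%N.
  by rewrite ltnNge (grid_index_le _ _ (ltW s0)) grid0 -ltNge.
case E : (grid_index n s) => [//|k] _ kN.
rewrite /grid_step (bigD1 (Ordinal kN))//= indicE mem_set ?mulr1; last first.
  rewrite /= in_itv/=; apply/andP; split.
    by rewrite ltNge -(grid_index_le _ _ (ltW s0)) E ltnn.
  by rewrite -(grid_index_le _ _ (ltW s0)) E.
rewrite big1 ?addr0// => i ik; rewrite indicE memNset ?mulr0//=.
rewrite in_itv/= => /andP[]; rewrite ltNge -!(grid_index_le _ _ (ltW s0)) E -ltnNge => h1 h2.
by move/negP : ik; apply; apply/eqP/val_inj => /=; apply/eqP; rewrite eqn_leq -ltnS h1 -ltnS h2.
Qed.

Lemma integral_grid_step n N (D : set R) : measurable D ->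
  `]0, grid n N]%classic `<=` D ->
  (\int[mu]_(s in D) (grid_step n N s)%:E = (riemann_sum f c n N)%:E)%E.
Proof.
move=> mD ND.
under eq_integral do rewrite -sumEFin.
rewrite ge0_integral_sum//=; last 2 first.
- by move=> i; apply/measurable_EFinP; exact: measurable_funM.
- by move=> i s _; rewrite lee_fin mulr_ge0 ?f_ge0 ?grid_ge0// indicE.
rewrite /riemann_sum -sumEFin; apply: eq_bigr => i _.
under eq_integral do rewrite EFinM.
rewrite ge0_integralZl//; last 2 first.
- by apply/measurable_EFinP; exact: measurable_indic.
- by rewrite lee_fin f_ge0 ?grid_ge0.
rewrite EFinM integral_indic// setIidl ?stieltjes_itv ?grid_ge0 ?grid_mono//.
move=> s /= ; rewrite in_itv/= => /andP[gs sg]; apply: ND; rewrite /= in_itv/=.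
rewrite (le_lt_trans (grid_ge0 n i) gs)/= (le_trans sg)// grid_mono.
exact: ltn_ord.
Qed.

Lemma cvg_grid_step (N : nat -> nat) s : 0 < s ->
  (\forall n \near \oo, s <= grid n (N n)) ->
  grid_step n (N n) s @[n --> \oo] --> f s.
Proof.
move=> s0 sN.
apply: (@cvg_trans _ (f (grid n (grid_index n s)) @[n --> \oo])).
  by apply: near_eq_cvg; apply: filterS sN => n sNn; rewrite grid_stepE.
have : (fun n => grid n (grid_index n s) : R) @ \oo --> within `[0, +oo[ (nbhs s).
  move=> B hB; have : \forall n \near \oo, `[0, +oo[%classic (grid n (grid_index n s) : R) ->
      B (grid n (grid_index n s)) := cvg_grid_index (ltW s0) hB.
  by apply: filterS => n; apply; rewrite /= in_itv/= andbT grid_ge0.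
move/cvg_comp; apply.
by move/subspace_continuousP : cf; apply; rewrite /= in_itv/= andbT ltW.
Qed.

Let mf : measurable_fun (`[0, +oo[%classic : set R) f.
Proof. exact: subspace_continuous_measurable_fun. Qed.

(** With [n * n.+1] cells of mesh 1 / (n + 1), the horizon is n: mesh and horizon are refined
    together, so the step functions converge to f at every s > 0. *)
Lemma stieltjes_integral_fatou :
  (stieltjes_integral f c <=
   limn_einf (fun n => (riemann_sum f c n (n * n.+1)%N)%:E))%E.
Proof.
rewrite /stieltjes_integral -/mu.
rewrite (_ : (fun n => _) = (fun n =>
    \int[mu]_(s in `[0%R, +oo[) (grid_step n (n * n.+1)%N s)%:E)%E); last first.
  apply/funext => n; rewrite integral_grid_step// => s /=.
  by rewrite !in_itv/= andbT => /andP[/ltW].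
apply: ae_fatou => //.
- by move=> n; apply/measurable_EFinP; exact: measurable_grid_step.
- by move=> n s _; rewrite lee_fin grid_step_ge0.
- by apply/measurable_EFinP; exact: mf.
- by move=> s; rewrite /= in_itv/= andbT => s0; rewrite lee_fin f_ge0.
exists [set 0]; split => //; first exact: stieltjes_set0.
move=> s /= /not_implyP[]; rewrite in_itv/= andbT le_eqVlt => /orP[/eqP <-//|s0].
move=> h; exfalso; apply: h.
have : (grid_step n (n * n.+1)%N s)%:E @[n --> \oo] --> (f s)%:E.
  apply: cvg_EFin; first exact: nearW.
  apply: cvg_grid_step => //; near=> n.
  rewrite /grid natrM mulfK//; near: n; exact: nbhs_infty_ger.
by move/cvg_limn_einf_sup => [-> _].
Unshelve. all: by end_near. Qed.

(** On a fixed horizon dc has finite mass, so the bound K dominates the step functions and the sums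
    have a true limit. *)
Lemma cvg_riemann_sum (N : nat) (K : R) : (forall t, 0 <= t -> f t <= K) ->
  ((riemann_sum f c n (N * n.+1)%N)%:E @[n --> \oo] -->
   \int[mu]_(s in `]0%R, N%:R]) (f s)%:E)%E.
Proof.
move=> fK; have K0 : 0 <= K by apply: le_trans (fK 0 (lexx _)); exact: f_ge0.
have sub : `]0%R, N%:R]%classic `<=` (`[0, +oo[%classic : set R).
  by move=> s /=; rewrite !in_itv/= andbT => /andP[/ltW].
have [|||||_ _] := @dominated_convergence _ _ _ mu `]0%R, N%:R] (measurable_itv _)
  (fun n s => (grid_step n (N * n.+1)%N s)%:E) (fun s => (f s)%:E) (cst K%:E).
- by move=> n; apply/measurable_EFinP; exact: measurable_grid_step.
- by apply/measurable_EFinP; exact: measurable_funS mf.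
- apply: aeW => s /=; rewrite in_itv/= => /andP[s0 sN].
  apply: cvg_EFin; first exact: nearW.
  apply: cvg_grid_step => //; apply: nearW => n.
  by rewrite /grid natrM mulfK.
- apply/integrableP; split; first exact: measurable_cst.
  rewrite (eq_integral (cst K%:E)); last by move=> s _ /=; rewrite ger0_norm.
  by rewrite integral_cst// stieltjes_itv// -EFinM ltry.
- apply: aeW => s n /=; rewrite in_itv/= => /andP[s0 sN].
  rewrite lee_fin ger0_norm ?grid_step_ge0// grid_stepE ?fK ?grid_ge0//.
  by rewrite /grid natrM mulfK.
apply: cvg_trans; rewrite (_ : (fun n => _) = (fun n =>
    \int[mu]_(s in `]0%R, N%:R]) (grid_step n (N * n.+1)%N s)%:E)%E)//.
apply/funext => n; rewrite integral_grid_step// => s /=.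
by rewrite /grid natrM mulfK.
Qed.

End riemann_sum.

(** * Expected Riemann sums *)

Lemma riemann_sum_cst (R : realType) (v : R) c n N :
  riemann_sum (fun=> v) c n N = v * (c (grid n N) - c 0).
Proof.
rewrite /riemann_sum -mulr_sumr; congr (_ * _).
elim: N => [|N ih]; first by rewrite big_ord0 grid0 subrr.
by rewrite big_ord_recr/= ih addrC addrA subrK.
Qed.

Section riemann_expectation.
Context {d : measure_display} {T : measurableType d} {R : realType}.
Variables (P : probability T R) (F : R -> set (set T)).
Hypothesis filF : filtration F.

Section comparison.
Variable A : R -> T -> R.
Hypothesis A_adapted : adapted F A.
Hypothesis A_nd : nondecreasing_process A.

Let incr n i w := A (grid n i.+1) w - A (grid n i) w.

Let incr_ge0 n i w : 0 <= incr n i w.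
Proof. by rewrite subr_ge0 A_nd ?grid_ge0 ?grid_mono. Qed.

Let incr_wrt n i : measurable_wrt (F (grid n i.+1)) (incr n i).
Proof.
have sF := filtration_sigma filF (grid_ge0 n i.+1).
apply/(measurable_wrtP sF)/measurable_funB; apply/(measurable_wrtP sF).
  exact/A_adapted/grid_ge0.
apply: (measurable_wrt_mon filF (grid_ge0 n i)); first by rewrite grid_mono.
exact/A_adapted/grid_ge0.
Qed.

Let m_incr n i : measurable_fun setT (incr n i).
Proof. exact: (measurable_wrt_fun filF (grid_ge0 n i.+1)). Qed.

Lemma measurable_riemann_sum (X : R -> T -> R) n N :
  (forall t, 0 <= t -> measurable_fun setT (X t)) ->
  measurable_fun setT (fun w => riemann_sum (X ^~ w) (A ^~ w) n N).
Proof.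
move=> mX; apply: measurable_sum => i; apply: measurable_funM.
  exact/mX/grid_ge0.
exact: m_incr.
Qed.

Lemma riemann_sum_ge0 (X : R -> T -> R) n N w :
  (forall t, 0 <= t -> 0 <= X t w) -> 0 <= riemann_sum (X ^~ w) (A ^~ w) n N.
Proof.
by move=> X0; apply: sumr_ge0 => i _; rewrite mulr_ge0 ?X0 ?grid_ge0// incr_ge0.
Qed.

Let integral_riemann_sum (X : R -> T -> R) n N :
  (forall t, 0 <= t -> measurable_fun setT (X t)) ->
  (forall t w, 0 <= t -> 0 <= X t w) ->
  (\int[P]_w (riemann_sum (X ^~ w) (A ^~ w) n N)%:E =
   \sum_(i < N) \int[P]_w ((incr n i w)%:E * (X (grid n i.+1) w)%:E))%E.
Proof.
move=> mX X0; rewrite -ge0_integral_sum//=; last 2 first.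
- move=> i; apply: emeasurable_funM; apply/measurable_EFinP; first exact: m_incr.
  exact/mX/grid_ge0.
- by move=> i w _; rewrite mule_ge0 ?lee_fin ?incr_ge0 ?X0 ?grid_ge0.
apply: eq_integral => w _; rewrite -sumEFin; apply: eq_bigr => i _.
by rewrite -EFinM mulrC.
Qed.

(** Each increment of A is a nonnegative weight known at the right endpoint of its cell, so a
    termwise comparison against such weights is enough. One of the two processes will be constant in
    time, which makes its sum telescope. *)
Lemma le_integral_riemann_sum (X X' : R -> T -> R) n N :
  (forall t, 0 <= t -> measurable_fun setT (X t)) ->
  (forall t w, 0 <= t -> 0 <= X t w) ->
  (forall t, 0 <= t -> measurable_fun setT (X' t)) ->
  (forall t w, 0 <= t -> 0 <= X' t w) ->
  (forall t (H : T -> R), 0 <= t -> t <= grid n N -> measurable_wrt (F t) H ->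
     (forall w, 0 <= H w) ->
     (\int[P]_w ((H w)%:E * (X t w)%:E) <= \int[P]_w ((H w)%:E * (X' t w)%:E))%E) ->
  (\int[P]_w (riemann_sum (X ^~ w) (A ^~ w) n N)%:E <=
   \int[P]_w (riemann_sum (X' ^~ w) (A ^~ w) n N)%:E)%E.
Proof.
move=> mX X0 mX' X'0 XX'; rewrite !integral_riemann_sum//.
by apply: lee_sum => i _; apply: XX' => //; rewrite ?grid_ge0 ?grid_mono.
Qed.

End comparison.

Variables M C : R -> T -> R.
Hypothesis cM : continuous_process M.
Hypothesis cC : continuous_process C.
Hypothesis martM : martingale P F M.
Hypothesis M_ge0 : forall t w, 0 <= t -> 0 <= M t w.
Hypothesis C_adapted : adapted F C.
Hypothesis C_nd : nondecreasing_process C.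
Hypothesis C0 : forall w, C 0 w = 1.

Let mM t : 0 <= t -> measurable_fun setT (M t).
Proof.
by have [aM _ _] := martM => t0; exact: (measurable_wrt_fun filF t0 (aM _ t0)).
Qed.

Let mC t : 0 <= t -> measurable_fun setT (C t).
Proof. by move=> t0; exact: (measurable_wrt_fun filF t0 (C_adapted t0)). Qed.

Let C_ge1 t w : 0 <= t -> 1 <= C t w.
Proof. by move=> t0; rewrite -(C0 w); exact: C_nd. Qed.

Let C_path w s t : 0 <= s -> s <= t -> C s w <= C t w.
Proof. exact: C_nd. Qed.

Let cM_path w : {within `[0, +oo[, continuous (M ^~ w)}.
Proof. exact: cM. Qed.

Let grid_natr N n : grid n (N * n.+1) = N%:R :> R.
Proof. by rewrite /grid natrM mulfK. Qed.

Lemma integral_stieltjes_le (B : \bar R) :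
  (forall n, \int[P]_w (M n%:R w * C n%:R w)%:E <= B)%E ->
  (\int[P]_w stieltjes_integral (M ^~ w) (C ^~ w) <= B)%E.
Proof.
move=> hB.
pose S n w := riemann_sum (M ^~ w) (C ^~ w) n (n * n.+1)%N.
have S0 n w : 0 <= S n w by apply: riemann_sum_ge0 => // t; exact: M_ge0.
have mS n : measurable_fun setT (fun w => (S n w)%:E).
  by apply/measurable_EFinP; apply: measurable_riemann_sum.
apply: (@le_trans _ _ (\int[P]_w limn_einf (fun n => (S n w)%:E)))%E.
  apply: le_integral_ge0 => w _.
    apply: integral_ge0 => t; rewrite /= in_itv/= andbT => t0.
    by rewrite lee_fin M_ge0.
  apply: stieltjes_integral_fatou => //.
  - by move=> s t s0 st; exact: C_path.
  - by move=> t; exact: M_ge0.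
apply: le_trans (fatou P measurableT mS _) _; first by move=> n w _; rewrite lee_fin.
apply: limn_einf_le; apply: nearW => n; apply: le_trans (hB n).
have n0 : 0 <= n%:R :> R by [].
apply: (@le_trans _ _ (\int[P]_w
    (riemann_sum (fun=> M n%:R w) (C ^~ w) n (n * n.+1)%N)%:E)%E).
  apply: (@le_integral_riemann_sum C C_adapted C_nd M (fun=> M n%:R)) => //.
  - by move=> t _; exact: mM.
  - by move=> t w _; exact: M_ge0.
  - move=> t H t0; rewrite grid_natr => tn mH H0.
    by rewrite (martingale_mul filF martM M_ge0 t0 tn mH H0).
apply: le_integral_ge0 => w _; rewrite riemann_sum_cst grid_natr lee_fin.
  by rewrite mulr_ge0 ?M_ge0// subr_ge0 C_nd.
by rewrite ler_wpM2l ?M_ge0// C0 gerBl.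
Qed.

(** Where M_s <= K, bound min(M_t, K) by M_t and use the martingale property; elsewhere min(M_s, K)
    is already the maximal value K. *)
Let supermartingale_min (K : R) s t A : 0 <= K -> 0 <= s -> s <= t -> F s A ->
  (\int[P]_(w in A) (Num.min (M t w) K)%:E <=
   \int[P]_(w in A) (Num.min (M s w) K)%:E)%E.
Proof.
move=> K0 s0 st FA; have t0 := le_trans s0 st.
have sF := filtration_sigma filF s0; have mF := filtration_measurable filF s0.
have [aM _ _] := martM.
have FS : F s [set w | M s w <= K].
  by apply: (measurable_wrt_le sF); [exact: aM|exact: (measurable_wrt_cst sF)].
pose A1 := A `&` [set w | M s w <= K].
pose A2 := A `\` [set w | M s w <= K].
have FA1 : F s A1 by exact: sigma_setI.
have FA2 : F s A2 by exact: sigma_setD.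
have A12 : A = A1 `|` A2 by rewrite setUIDK.
have dA : [disjoint A1 & A2] by apply/disj_setPS => w [[_ ?] [_]].
have mA1 := mF _ FA1; have mA2 := mF _ FA2.
have mmin u D : 0 <= u -> measurable_fun D (fun w => (Num.min (M u w) K)%:E).
  move=> u0; apply: measurable_funTS; apply/measurable_EFinP.
  by apply: measurable_minr => //; exact: mM.
have min0 u w : 0 <= u -> (0 <= (Num.min (M u w) K)%:E)%E.
  by move=> u0; rewrite lee_fin le_min M_ge0.
rewrite A12 !ge0_integral_setU//; try (by move=> w _; exact: min0); try exact: mmin.
apply: leeD.
  apply: (@le_trans _ _ (\int[P]_(w in A1) (M t w)%:E)%E).
    by apply: le_integral_ge0 => w _; [exact: min0|rewrite lee_fin ge_min lexx].
  rewrite -(martingale_integral martM s0 st FA1); apply: le_integral_ge0 => w.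
    by rewrite lee_fin M_ge0.
  by move=> [_ /= MK]; rewrite lee_fin le_min lexx.
apply: le_integral_ge0 => w; first by move=> _; exact: min0.
move=> [_ /= /negP]; rewrite -ltNge => KM.
by rewrite lee_fin [leRHS]min_r ?(ltW KM)// ge_min lexx orbT.
Qed.

(** [S'] uses both truncations and carries the lower bound in expectation; [S] keeps the increments
    of C itself, so that it converges to an integral against dC. They compare because x |-> min(x,
    K) does not enlarge increments. The term [Num.min 1 K] is the truncated initial value of C. *)
Let integral_truncated_le (N : nat) (K : R) : 0 <= K ->
  (\int[P]_w (Num.min (M N%:R w) K * (Num.min (C N%:R w) K - Num.min 1 K))%:E <=
   \int[P]_w stieltjes_integral (M ^~ w) (C ^~ w))%E.
Proof.
move=> K0.
have N0 : 0 <= N%:R :> R by [].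
pose MK t w := Num.min (M t w) K; pose CK t w := Num.min (C t w) K.
have MK0 t w : 0 <= t -> 0 <= MK t w by move=> t0; rewrite le_min M_ge0.
have mMK t : 0 <= t -> measurable_fun setT (MK t).
  by move=> t0; apply: measurable_minr => //; exact: mM.
have aCK : adapted F CK.
  move=> t t0; have sF := filtration_sigma filF t0.
  by apply/(measurable_wrtP sF)/measurable_minr => //; apply/(measurable_wrtP sF)/C_adapted.
have CK_nd : nondecreasing_process CK.
  by move=> w s t s0 st; apply: le_min2 => //; exact: C_nd.
pose S n w := riemann_sum (MK ^~ w) (C ^~ w) n (N * n.+1)%N.
pose S' n w := riemann_sum (MK ^~ w) (CK ^~ w) n (N * n.+1)%N.
pose I w := (\int[lebesgue_stieltjes_measure (cumulative_path (C ^~ w))]_(s in `]0%R, N%:R])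
  (MK s w)%:E)%E.
have cMK w : {within `[0, +oo[, continuous (MK ^~ w)}.
  move=> t; apply: (@continuous_min R (subspace (`[0, +oo[ : set R)) _ (cst K)).
    exact: cM_path.
  exact: cst_continuous.
have SI w : (S n w)%:E @[n --> \oo] --> I w.
  apply: (@cvg_riemann_sum _ _ _ _ _ _ _ _ K) => //.
  - by move=> s t s0 st; exact: C_path.
  - by move=> t; exact: MK0.
  - by move=> t _; rewrite /MK ge_min lexx orbT.
have S0 n w : 0 <= S n w by apply: riemann_sum_ge0 => // t; exact: MK0.
have mS n : measurable_fun setT (fun w => (S n w)%:E).
  by apply/measurable_EFinP; apply: measurable_riemann_sum.
have I0 w : (0 <= I w)%E.
  by apply: integral_ge0 => t /=; rewrite in_itv/= => /andP[/ltW t0 _]; rewrite lee_fin MK0.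
have mI : measurable_fun setT I.
  by apply: (@emeasurable_fun_cvg _ _ _ _ (fun n w => (S n w)%:E) _ mS) => w _; exact: SI.
have S'K n w : S' n w <= K * K.
  apply: (@le_trans _ _ (riemann_sum (fun=> K) (CK ^~ w) n (N * n.+1)%N)).
    apply: ler_sum => i _; rewrite ler_wpM2r//; last by rewrite ge_min lexx orbT.
    by rewrite subr_ge0 CK_nd ?grid_ge0 ?grid_mono.
  rewrite riemann_sum_cst ler_wpM2l// lerBlDr (@le_trans _ _ K)//.
    by rewrite ge_min lexx orbT.
  by rewrite lerDl le_min K0 (le_trans _ (C_ge1 _ _)).
have S'S n w : S' n w <= S n w.
  apply: ler_sum => i _; rewrite ler_wpM2l ?MK0 ?grid_ge0//.
  have : C (grid n i) w <= C (grid n i.+1) w by rewrite C_nd ?grid_ge0 ?grid_mono.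
  rewrite /CK; move: (C _ _) (C _ _) => b a ba.
  by rewrite /Num.min; case: ltP => ?; case: ltP => ?; lra.
(* [S n] is unbounded in w. Since [S'] is at most both [S] and K * K, capping [S] at K * K keeps the
   lower bound and permits bounded convergence. *)
have alpha n : (\int[P]_w (Num.min (M N%:R w) K * (Num.min (C N%:R w) K - Num.min 1 K))%:E <=
    \int[P]_w mine (S n w)%:E (K * K)%:E)%E.
  rewrite (eq_integral (fun w =>
      (riemann_sum (fun=> MK N%:R w) (CK ^~ w) n (N * n.+1)%N)%:E)); last first.
    by move=> w _; rewrite riemann_sum_cst grid_natr /CK C0.
  apply: (@le_trans _ _ (\int[P]_w (S' n w)%:E)%E).
    apply: (@le_integral_riemann_sum CK aCK CK_nd (fun=> MK N%:R) MK) => //.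
    - by move=> t _; exact: mMK.
    - by move=> t w _; exact: MK0.
    - move=> t H t0; rewrite grid_natr => tN mH H0.
      apply: le_integral_mul (filtration_sigma filF t0) _ _ _ _ _ _ mH H0.
      + exact: filtration_measurable.
      + by apply/measurable_EFinP; exact: mMK.
      + by move=> w; rewrite lee_fin MK0.
      + by apply/measurable_EFinP; exact: mMK.
      + by move=> w; rewrite lee_fin MK0.
      + by move=> A FA; exact: supermartingale_min.
  apply: le_integral_ge0 => w _.
    by rewrite lee_fin; apply: riemann_sum_ge0 => // t; exact: MK0.
  by rewrite le_min !lee_fin S'S S'K.
have KK0 : 0 <= K * K by exact: mulr_ge0.
have mine_le (x : \bar R) : (0 <= x)%E -> (`|mine x (K * K)%:E| <= (K * K)%:E)%E.
  by move=> x0; rewrite gee0_abs ?le_min ?x0 ?lee_fin// ge_min lexx orbT.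
have [|||||_ _ SIK] := @dominated_convergence _ _ _ P setT measurableT
    (fun n w => mine (S n w)%:E (K * K)%:E) (fun w => mine (I w) (K * K)%:E)
    (cst (K * K)%:E).
- by move=> n; exact: measurable_mine.
- exact: measurable_mine.
- by apply: aeW => w _; apply: cvg_mine.
- exact: finite_measure_integrable_cst.
- by apply: aeW => w n _; apply: mine_le; rewrite lee_fin.
apply: (@le_trans _ _ (\int[P]_w mine (I w) (K * K)%:E)%E).
  rewrite -(cvg_lim _ SIK)//; apply: lime_ge; first by apply/cvg_ex; eexists; exact: SIK.
  by apply: nearW => n; exact: alpha.
apply: le_integral_ge0 => w _; first by rewrite le_min I0 lee_fin.
apply: (@le_trans _ _ (I w)); first by rewrite ge_min lexx.
rewrite /I /stieltjes_integral.
have mMw : measurable_fun (`[0%R, +oo[%classic : set R) (M ^~ w).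
  by apply: subspace_continuous_measurable_fun => //; exact: cM_path.
apply: (@le_trans _ _ (\int[lebesgue_stieltjes_measure (cumulative_path (C ^~ w))]_(s in `]0%R, N%:R])
  (M s w)%:E)%E).
  apply: le_integral_ge0 => s /=; rewrite in_itv/= => /andP[/ltW s0 _].
    by rewrite lee_fin MK0.
  by rewrite lee_fin ge_min lexx.
apply: ge0_subset_integral => //.
- exact/measurable_EFinP.
- by move=> s /=; rewrite in_itv/= andbT => s0; rewrite lee_fin M_ge0.
- by move=> s /=; rewrite !in_itv/= andbT => /andP[/ltW].
Qed.

(** The summand 1 is E[M_n] = E[M_0], from writing M_n C_n = M_n (C_n - 1) + M_n. At each w the
    truncations are inactive once the level is large, so Fatou removes them. *)
Lemma integral_prod_le (n : nat) : (forall w, M 0 w = 1) ->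
  (\int[P]_w (M n%:R w * C n%:R w)%:E <=
   \int[P]_w stieltjes_integral (M ^~ w) (C ^~ w) + 1)%E.
Proof.
move=> M0; have n0 : 0 <= n%:R :> R by [].
have mprod : measurable_fun setT (fun w => (M n%:R w * (C n%:R w - 1))%:E).
  apply/measurable_EFinP; apply: measurable_funM; first exact: mM.
  by apply: measurable_funB => //; exact: mC.
have prod0 w : 0 <= M n%:R w * (C n%:R w - 1).
  by rewrite mulr_ge0 ?M_ge0// subr_ge0 C_ge1.
have mmin (X : T -> R) (K : R) : measurable_fun setT X ->
    measurable_fun setT (fun w => Num.min (X w) K).
  by move=> mX; exact: measurable_minr.
have main : (\int[P]_w (M n%:R w * (C n%:R w - 1))%:E <=
    \int[P]_w stieltjes_integral (M ^~ w) (C ^~ w))%E.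
  apply: (@fatou_le _ _ _ _ _ (fun k w =>
    (Num.min (M n%:R w) k%:R * (Num.min (C n%:R w) k%:R - Num.min 1 k%:R))%:E)) => //.
  - move=> k; apply/measurable_EFinP; apply: measurable_funM; first exact/mmin/mM.
    by apply: measurable_funB => //; exact/mmin/mC.
  - move=> k w _; rewrite lee_fin; apply: mulr_ge0; first by rewrite le_min M_ge0//=.
    by rewrite subr_ge0; apply: le_min2 => //; exact: C_ge1.
  - by move=> w _; rewrite lee_fin.
  - apply: aeW => w _.
    rewrite (cvg_limn_einf_sup (_ : _ --> (M n%:R w * (C n%:R w - 1))%:E)).1//.
    apply: cvg_near_cst; near=> k.
    rewrite !min_l//; near: k; exact: nbhs_infty_ger.
  - by apply: nearW => k; exact: integral_truncated_le.
have int1 : (\int[P]_w (M n%:R w)%:E = 1)%E.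
  rewrite -(martingale_integral martM (lexx 0) n0)//.
    under eq_integral do rewrite M0.
    by rewrite integral_cst// mul1e; exact: probability_setT.
  by rewrite -(g_sigma_measurableE (filtration_sigma filF (lexx 0))).
rewrite (eq_integral (fun w => (M n%:R w * (C n%:R w - 1))%:E + (M n%:R w)%:E)%E); last first.
  by move=> w _; rewrite -EFinD mulrBr mulr1 subrK.
rewrite ge0_integralD//.
- by rewrite int1; exact: leeD2r.
- by move=> w _; rewrite lee_fin.
- by move=> w _; rewrite lee_fin M_ge0.
- by apply/measurable_EFinP; exact: mM.
Unshelve. all: by end_near. Qed.

End riemann_expectation.

(** * From class (D) to the martingale property *)

Section stopping_times.
Context {d : measure_display} {T : measurableType d} {R : realType}.
Variable F : R -> set (set T).
Hypothesis filF : filtration F.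

Lemma filtration_setT t : 0 <= t -> F t setT.
Proof. by move=> t0; rewrite -(g_sigma_measurableE (filtration_sigma filF t0)). Qed.

Lemma filtration_set0 t : 0 <= t -> F t set0.
Proof. by move=> t0; rewrite -(g_sigma_measurableE (filtration_sigma filF t0)). Qed.

Lemma stopping_time_cst t : 0 <= t -> stopping_time F (fun=> t%:E).
Proof.
move=> t0; split=> [w|u u0]; first by rewrite lee_fin.
have [tu|ut] := leP t u.
  rewrite (_ : [set w | _] = setT); first exact: filtration_setT.
  by apply/seteqP; split => // w _ /=; rewrite lee_fin.
rewrite (_ : [set w | _] = set0); first exact: filtration_set0.
by apply/seteqP; split => // w /=; rewrite lee_fin leNgt ut.
Qed.

Lemma stopping_time_min t (tau : T -> \bar R) : 0 <= t -> stopping_time F tau ->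
  stopping_time F (fun w => mine t%:E (tau w)).
Proof.
move=> t0 [tau0 Ftau]; split=> [w|u u0]; first by rewrite le_min lee_fin t0 tau0.
rewrite (_ : [set w | _] = [set w | (t%:E <= u%:E)%E] `|` [set w | (tau w <= u%:E)%E]).
  apply: (sigma_setU (filtration_sigma filF u0)); last exact: Ftau.
  by have [_] := stopping_time_cst t0; apply.
by apply/seteqP; split => w /=; rewrite ge_min => /orP.
Qed.

End stopping_times.

Section class_D_martingale.
Context {d : measure_display} {T : measurableType d} {R : realType}.
Variables (P : probability T R) (F : R -> set (set T)).
Hypothesis filF : filtration F.
Variables Y M C : R -> T -> R.
Hypothesis Y_ge0 : forall t w, 0 <= t -> 0 <= Y t w.
Hypothesis M_ge0 : forall t w, 0 <= t -> 0 <= M t w.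
Hypothesis M_loc : local_martingale P F M.
Hypothesis M0 : forall w, M 0 w = 1.
Hypothesis C_nd : nondecreasing_process C.
Hypothesis C0 : forall w, C 0 w = 1.
Hypothesis YE : forall t w, 0 <= t -> Y t w = M t w * C t w - 1.
Hypothesis DY : class_D P F Y.

Let M_le t w : 0 <= t -> M t w <= Y t w + 1.
Proof.
move=> t0; rewrite YE// subrK ler_peMr ?M_ge0// -(C0 w); exact: C_nd.
Qed.

(** As C >= 1, M <= Y + 1, which shifts the level by one. One K serves all finite stopping times:
    constant ones for M itself, truncated localizing ones for the stopped processes. *)
Let excess_M (e : R) : 0 < e -> exists2 K : R, 0 <= K &
  forall tau, stopping_time F tau -> (forall w, (tau w < +oo)%E) ->
  (\int[P]_w excess K (Y (fine (tau w)) w)%:E <= e%:E)%E /\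
  (\int[P]_w excess (K + 1) (M (fine (tau w)) w)%:E <= e%:E)%E.
Proof.
move=> e0; have [mD _] := DY.
have /(uniformly_integrableP P mD)[+ _] : forall Z w,
    [set (fun w => Y (fine (tau w)) w) | tau in
       [set tau | stopping_time F tau /\ forall w, (tau w < +oo)%E]] Z -> 0 <= Z w.
  by move=> _ w [tau [[tau0 _] _] <-]; apply: Y_ge0; exact: fine_ge0.
move=> /(_ DY _ e0)[K K0 hK]; exists K => // tau st fin.
have YK : (\int[P]_w excess K (Y (fine (tau w)) w)%:E <= e%:E)%E.
  by apply: (hK (fun w => Y (fine (tau w)) w)); exists tau.
split => //; apply: le_trans YK; apply: le_integral_ge0 => w _; first exact: excess_ge0.
have := @M_le (fine (tau w)) w (fine_ge0 (st.1 w)).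
rewrite !excessEFin lee_fin => MY.
by apply: le_max2 => //; rewrite lerBlDr addrAC -addrA addrCA; lra.
Qed.

Let small_excess_M : small_excess P [set M t | t in `[0, +oo[].
Proof.
move=> e e0; have [K K0 hK] := excess_M e0; exists (K + 1); first exact: addr_ge0.
move=> _ [t /= + <-]; rewrite in_itv/= andbT => t0.
have [] // := hK (fun=> t%:E); first exact: stopping_time_cst.
by move=> w; exact: ltry.
Qed.

Let mM t : 0 <= t -> measurable_fun setT (M t).
Proof. by have [aM _] := M_loc => t0; exact: (measurable_wrt_fun filF t0 (aM _ t0)). Qed.

Let integrable_M t : 0 <= t -> P.-integrable setT (EFin \o M t).
Proof.
move=> t0; apply/integrableP; split; first by apply/measurable_EFinP; exact: mM.
have [K K0 hK] := small_excess_M (@ltr01 R).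
apply: (@le_lt_trans _ _ (\int[P]_w (K%:E + excess K (M t w)%:E))%E).
  apply: le_integral_ge0 => w _; first exact: abse_ge0.
  by rewrite gee0_abs ?lee_fin ?M_ge0//; exact: le_cst_excess.
rewrite ge0_integralD//; last 2 first.
- by move=> w _; exact: excess_ge0.
- by apply: measurable_excess; apply/measurable_EFinP; exact: mM.
rewrite integral_cst//; apply: lte_add_pinfty.
  by rewrite lte_mul_pinfty// (le_lt_trans (probability_le1 P measurableT))// ltry.
apply: (le_lt_trans (hK (M t) _)); last exact: ltry.
by exists t => //=; rewrite in_itv/= andbT.
Qed.

(* Along a localizing sequence the stopped processes are dominated by 1 + Y at a
   finite stopping time, so the martingale property survives the limit. *)
Let cvg_stopped (tau : nat -> T -> \bar R) t A :
  (forall n, stopping_time F (tau n)) ->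
  {ae P, forall w, tau n w @[n --> \oo] --> +oo%E} ->
  (forall n, measurable_fun setT (stopped_process M (tau n) t)) ->
  0 <= t -> measurable A ->
  (\int[P]_(w in A) (stopped_process M (tau n) t w)%:E @[n --> \oo] -->
   \int[P]_(w in A) (M t w)%:E)%E.
Proof.
move=> st tauoo mU t0 mA.
have min0 n w : 0 <= fine (mine t%:E (tau n w)).
  by apply: fine_ge0; rewrite le_min lee_fin t0; exact: (st n).1.
apply: (@vitali _ _ _ _ (fun n => stopped_process M (tau n) t)) => //.
- by move=> n w; exact: M_ge0.
- by apply/measurable_EFinP; exact: mM.
- by move=> w; rewrite lee_fin M_ge0.
- apply: filterS tauoo => w /cvgeyPge/(_ t) tw; apply: cvg_near_cst.
  by apply: filterS tw => n tn; rewrite /stopped_process min_l.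
move=> e e0; have [K K0 hK] := excess_M e0; exists (K + 1); first exact: addr_ge0.
move=> _ [n _ <-]; have [] // := hK (fun w => mine t%:E (tau n w)).
  exact: stopping_time_min.
by move=> w; rewrite gt_min ltry.
Qed.

Let martingale_M : martingale P F M.
Proof.
have [aM [tau [st tauoo martS]]] := M_loc.
split => // s t s0 st'; split; [exact: aM|exact: integrable_M|].
move=> A FA; have t0 := le_trans s0 st'.
have mA := filtration_measurable filF s0 FA.
have oo : {ae P, forall w, tau n w @[n --> \oo] --> +oo%E}.
  by apply: filterS tauoo => w [].
(* Localization makes the stopped process minus M_0 a martingale; the constant 1 is added back and
   its integral cancels on both sides. *)
have SE n u w : stopped_process M (tau n) u w =
    (stopped_process M (tau n) u w - M 0 w) + 1 by rewrite M0 subrK.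
have mS n u : 0 <= u -> measurable_fun setT (stopped_process M (tau n) u).
  move=> u0; have [aS _ _] := martS n; rewrite (funext (SE n u)).
  by apply: measurable_funD => //; exact: (measurable_wrt_fun filF u0 (aS _ u0)).
have Seq n : (\int[P]_(w in A) (stopped_process M (tau n) s w)%:E =
              \int[P]_(w in A) (stopped_process M (tau n) t w)%:E)%E.
  have [_ iS _] := martS n.
  have iSA u : 0 <= u -> P.-integrable A
      (EFin \o (fun w => stopped_process M (tau n) u w - M 0 w)).
    by move=> u0; apply: (@integrableS _ _ _ _ setT) => //; exact: iS.
  have i1 : P.-integrable A (cst 1%:E) by exact: finite_measure_integrable_cst.
  under eq_integral do rewrite SE EFinD.
  under [RHS]eq_integral do rewrite SE EFinD.
  rewrite integralD//; last exact: iSA.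
  rewrite [RHS]integralD//; last exact: iSA.
  by rewrite (martingale_integral (martS n) s0 st' FA).
have h := cvg_stopped st oo (fun n => mS n _ t0) t0 mA.
have := cvg_stopped st oo (fun n => mS n _ s0) s0 mA.
by under eq_fun do rewrite Seq; move/cvg_unique; apply.
Qed.

Lemma class_D_ui_martingale : ui_martingale P F M.
Proof.
split; first exact: martingale_M.
apply/uniformly_integrableP => //.
- by move=> _ [t /= + <-]; rewrite in_itv/= andbT; exact: mM.
- by move=> _ w [t /= + <-]; rewrite in_itv/= andbT; exact: M_ge0.
Qed.

Lemma class_D_integral_le : exists B : R, forall n,
  (\int[P]_w (M n%:R w * C n%:R w)%:E <= B%:E)%E.
Proof.
(* M_n C_n = 1 + Y_n <= 1 + K + (Y_n - K)^+, and the last term has expectation at most 1. *)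
have [K K0 hK] := excess_M (@ltr01 R); exists (1 + K + 1) => n.
have n0 : 0 <= n%:R :> R by [].
have [mD _] := DY.
have mY : measurable_fun setT (Y n%:R).
  apply: (mD (Y n%:R)); exists (fun=> n%:R%:E) => //; split => [|w]; last exact: ltry.
  exact: stopping_time_cst.
have [YK _] : (\int[P]_w excess K (Y (fine n%:R%:E) w)%:E <= 1%:E)%E /\
   (\int[P]_w excess (K + 1) (M (fine n%:R%:E) w)%:E <= 1%:E)%E.
  by apply: (hK (fun=> n%:R%:E)) => [|w]; [exact: stopping_time_cst|exact: ltry].
apply: (@le_trans _ _ (\int[P]_w ((1 + K)%:E + excess K (Y n%:R w)%:E))%E).
  apply: le_integral_ge0 => w _.
    have : 0 <= Y n%:R w + 1 by rewrite addr_ge0 ?Y_ge0.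
    by rewrite YE// subrK lee_fin.
  rewrite -[M _ _ * _](subrK 1) -YE// EFinD addeC [(1 + K)%:E]EFinD -addeA.
  by apply: leeD2l; exact: le_cst_excess.
rewrite ge0_integralD//; last 3 first.
- by move=> w _; rewrite lee_fin addr_ge0.
- by move=> w _; exact: excess_ge0.
- by apply: measurable_excess; exact/measurable_EFinP.
rewrite [leRHS]EFinD; apply: leeD => //.
by rewrite integral_cst//= -[leRHS]mule1 lee_wpmul2l ?probability_le1// lee_fin addr_ge0.
Qed.

End class_D_martingale.

(** * Cyclic proof of the equivalence of class (D) with the two integrability conditions *)

Unset Implicit Arguments.

Theorem proposition2p3 (d : measure_display) (T : measurableType d)
    (R : realType) (P : probability T R) (F : R -> set (set T))
    (Y M C : R -> T -> R)
    (usualF : usual_conditions P F)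
    (cY : continuous_process Y)
    (Y_ge0 : forall (t : R) (w : T), 0 <= t -> 0 <= Y t w)
    (Y_locsub : local_submartingale P F Y)
    (Y0 : forall w, Y 0 w = 0)
    (cM : continuous_process M)
    (M_gt0 : forall (t : R) (w : T), 0 <= t -> 0 < M t w)
    (M_loc : local_martingale P F M)
    (M0 : forall w, M 0 w = 1)
    (cC : continuous_process C)
    (C_adapted : adapted F C)
    (C_nd : nondecreasing_process C)
    (C0 : forall w, C 0 w = 1)
    (YE : forall (t : R) (w : T), 0 <= t -> Y t w = M t w * C t w - 1) :
  [<-> class_D P F Y;
       ui_martingale P F M /\
         (\int[P]_w (terminal M w * terminal C w) < +oo)%E;
       ui_martingale P F M /\
         (\int[P]_w stieltjes_integral (M ^~ w) (C ^~ w) < +oo)%E].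
Proof.
have [filF _ null] := usualF.
have M_ge0 t w : 0 <= t -> 0 <= M t w by move=> t0; exact/ltW/M_gt0.
(* [terminal M] takes a default value where the limit fails to exist. Completeness, which comes from
   the null sets in F_0, transfers measurability to it from [terminal_inf M]. *)
have complete : measure_is_complete P.
  by move=> N nN; apply: (filtration_measurable filF (lexx 0)); exact: null.
have uiE : ui_martingale P F M -> small_excess P [set M t | t in `[0, +oo[].
  move=> [_ UI]; apply/uniformly_integrableP => //; first exact: UI.1.
  by move=> _ w [t /= + <-]; rewrite in_itv/= andbT; exact: M_ge0.
have terminalE : ui_martingale P F M ->
    (\int[P]_w (terminal M w * terminal C w) =
     \int[P]_w (terminal_inf M w * terminal C w))%E.
  move=> ui; have [martM _] := ui.
  have mZ := measurable_terminal_prod filF martM C_adapted C_nd.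
  have aeE : ae_eq P setT (fun w => terminal_inf M w * terminal C w)%E
      (fun w => terminal M w * terminal C w)%E.
    by apply: filterS (terminal_infE filF cM martM M_ge0 (uiE ui)) => w -> _.
  by apply/esym/ae_eq_integral => //; exact: ae_measurable_fun complete _ _ _ aeE mZ.
tfae.
- move=> DY; have ui := class_D_ui_martingale filF Y_ge0 M_ge0 M_loc M0 C_nd C0 YE DY.
  have [martM _] := ui; split => //; rewrite terminalE//.
  have [B hB] := class_D_integral_le filF Y_ge0 M_ge0 C_nd C0 YE DY.
  apply: le_lt_trans (ltry B).
  exact: (le_integral_terminal filF cM martM M_ge0 (uiE ui) C_adapted C_nd C0).
- move=> [ui]; have [martM _] := ui; rewrite terminalE// => Zoo; split => //.
  apply: le_lt_trans Zoo.
  apply: (integral_stieltjes_le filF cM cC martM M_ge0 C_adapted C_nd C0) => n.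
  exact: (integral_le_terminal filF cM martM M_ge0 (uiE ui) C_adapted C_nd C0).
- move=> [ui]; have [martM _] := ui => Joo.
  pose Z w := (terminal_inf M w * terminal C w)%E.
  have mZ : measurable_fun setT Z.
    exact: (measurable_terminal_prod filF martM C_adapted C_nd).
  have Z0 w : (0 <= Z w)%E by exact: terminal_prod_ge0.
  (* The way back to class (D) recovers E[Z] < oo first, from a bound on E[M_n C_n] that is uniform
     in n. *)
  have Zoo : (\int[P]_w Z w < +oo)%E.
    apply: (@le_lt_trans _ _
      (\int[P]_w stieltjes_integral (M ^~ w) (C ^~ w) + 1)%E); last first.
      by rewrite lte_add_pinfty// ltry.
    apply: (le_integral_terminal filF cM martM M_ge0 (uiE ui) C_adapted C_nd C0) => n.
    exact: (integral_prod_le filF cM cC martM M_ge0 C_adapted C_nd C0).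
  have YT tau w : stopping_time F tau ->
      Y (fine (tau w)) w = M (fine (tau w)) w * C (fine (tau w)) w - 1.
    by move=> [tau0 _]; rewrite YE// fine_ge0.
  apply/uniformly_integrableP.
  + move=> _ [tau [st fin] <-]; rewrite (funext (fun w => YT tau w st)).
    apply: measurable_funB => //.
    exact: (measurable_stopped_prod filF cM cC martM C_adapted st fin).
  + by move=> _ w [tau [[tau0 _] _] <-]; apply: Y_ge0; exact: fine_ge0.
  (* The expected excess of Z bounds that of M C, hence of Y <= M C, at every finite stopping time,
     so a level chosen for Z alone is uniform. *)
  + move=> e e0; have [K K0 hK] := excess_tail mZ Z0 Zoo e0; exists K => //.
    move=> _ [tau [st fin] <-]; apply: le_trans hK.
    apply: le_trans (integral_excess_stopped filF cM cC martM M_ge0 (uiE ui) C_adapted C_nd C0 st fin K0).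
    apply: le_integral_ge0 => w _; first exact: excess_ge0.
    by apply: le_excess; rewrite YT// lee_fin gerBl.
Qed.
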